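(* Let $\{\Phi^{(n)}\}_{n \geq 1}$ be a sequence of finite crystallographic root systems and, for each $n$, let $\Psi^{(n)}$ be an antichain in the root poset of $\Phi^{(n)}$, such that $|\Psi^{(n)}| \to \infty$. Then the sequence of random variables $\mathcal{X}_{\Psi^{(n)}}$ is asymptotically normal, i.e. \[ \frac{\mathcal{X}_{\Psi^{(n)}}-\mathbb{E}[\mathcal{X}_{\Psi^{(n)}}]}{\operatorname{Var}(\mathcal{X}_{\Psi^{(n)}})^{1/2}} \longrightarrow \mathcal{N}(0,1) \text{ in distribution.} \] Moreover, the rate of convergence in distribution is bounded by $|\Psi^{(n)}|^{-1/2}$: there is a constant $C$ with $\sup_{x\in\mathbb{R}}\big|\mathbb{P}\big(\tfrac{\mathcal{X}_{\Psi^{(n)}}-\mathbb{E}[\mathcal{X}_{\Psi^{(n)}}]}{\operatorname{Var}(\mathcal{X}_{\Psi^{(n)}})^{1/2}}\le x\big)-\mathbb{P}(\mathcal{N}(0,1)\le x)\big| \le C\,|\Psi^{(n)}|^{-1/2}$ for all sufficiently large $n$.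
   Context: A finite crystallographic root system $\Phi \subset V$ (a Euclidean space with inner product $\langle\cdot,\cdot\rangle$) comes with a choice of simple roots $\Delta$ and positive roots $\Phi^+$, $\Phi = \Phi^+ \cup (-\Phi^+)$; every positive root is a nonnegative integer combination of simple roots. The root poset is the partial order on $\Phi^+$ generated by the cover relations $\beta \prec \gamma$ whenever $\gamma-\beta \in \Delta$. An antichain is a set of pairwise incomparable positive roots. $W$ denotes the Weyl group of $\Phi$ (generated by the reflections $s_\alpha$, $\alpha\in\Delta$). For $\beta\in\Phi^+$, $\mathcal{X}_\beta$ is the Bernoulli random variable on $W$ (with the uniform distribution) given by $\mathcal{X}_\beta(w)=1$ if $w(\beta)\in -\Phi^+$ and $\mathcal{X}_\beta(w)=0$ if $w(\beta)\in\Phi^+$. For $\Psi\subseteq\Phi^+$, $\mathcal{X}_\Psi=\sum_{\beta\in\Psi}\mathcal{X}_\beta$. *)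

(* Defs.v *)
From HB Require Import structures.
From mathcomp Require Import all_boot all_order all_algebra all_fingroup.
From mathcomp Require Import all_classical all_reals all_analysis.
From Stdlib Require Import Relations.
Set Implicit Arguments. Unset Strict Implicit. Unset Printing Implicit Defensive.
Import Order.TTheory GRing.Theory Num.Theory.
Local Open Scope ring_scope.

Section RootSystems.
Variables (R : realType) (d : nat).
Local Notation V := 'rV[R]_d.

Definition dotv (u v : V) : R := (u *m v^T) 0 0.

Definition refl (a v : V) : V := v - ((2 * dotv v a) / dotv a a) *: a.

Definition crystallographic_root_system (Phi : seq V) : Prop :=
  [/\ uniq Phi, (0 : V) \notin Phi,
      forall a b, a \in Phi -> b \in Phi -> refl a b \in Phi,
      forall a b, a \in Phi -> b \in Phi -> (2 * dotv b a) / dotv a a \is a Num.int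
    & forall a (c : R), a \in Phi -> c *: a \in Phi -> c = 1 \/ c = -1].

Definition nonneg_int_comb (Delta : seq V) (v : V) : Prop :=
  exists c : 'I_(size Delta) -> nat, v = \sum_(i < size Delta) (c i)%:R *: Delta`_i.

Definition simple_system (Phi Delta : seq V) : Prop :=
  [/\ {subset Delta <= Phi}, free Delta &
      forall b, b \in Phi -> nonneg_int_comb Delta b \/ nonneg_int_comb Delta (- b)].

Definition positive_root (Phi Delta : seq V) (b : V) : Prop :=
  b \in Phi /\ nonneg_int_comb Delta b.

Definition root_cover (Phi Delta : seq V) (b g : V) : Prop :=
  [/\ positive_root Phi Delta b, positive_root Phi Delta g & g - b \in Delta].

Definition root_le (Phi Delta : seq V) : relation V :=
  clos_refl_trans V (root_cover Phi Delta).

Definition is_antichain (Phi Delta : seq V) (Psi : {set seq_sub Phi}) : Prop :=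
  (forall b, b \in Psi -> positive_root Phi Delta (val b)) /\
  (forall b g, b \in Psi -> g \in Psi -> b != g -> ~ root_le Phi Delta (val b) (val g)).

Definition refl_fun (Phi : seq V) (a : V) (x : seq_sub Phi) : seq_sub Phi :=
  odflt x (insub (refl a (val x))).

Definition perm_of_fun (T : finType) (f : T -> T) : {perm T} :=
  match @idP (injectiveb f) with
  | ReflectT H => perm (injectiveP f H)
  | ReflectF _ => 1%g
  end.

Definition weyl_group (Phi Delta : seq V) : {group {perm seq_sub Phi}} :=
  <<[set perm_of_fun (@refl_fun Phi (val x)) | x : seq_sub Phi & val x \in Delta]>>%G.

Definition is_negative_root (Phi Delta : seq V) (v : V) : bool :=
  `[< positive_root Phi Delta (- v) >].

Definition X_root (Phi Delta : seq V) (b : seq_sub Phi) (w : {perm seq_sub Phi}) : nat :=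
  is_negative_root Phi Delta (val (w b)).

Definition X_set (Phi Delta : seq V) (Psi : {set seq_sub Phi}) (w : {perm seq_sub Phi}) : nat :=
  \sum_(b in Psi) X_root Delta b w.

End RootSystems.

Section UniformProbability.
Variable (R : realType).
Definition unif_mean (T : finType) (W : {set T}) (Z : T -> R) : R :=
  (\sum_(w in W) Z w) / #|W|%:R.
Definition unif_var (T : finType) (W : {set T}) (Z : T -> R) : R :=
  unif_mean W (fun w => (Z w - unif_mean W Z) ^+ 2).
Definition unif_cdf (T : finType) (W : {set T}) (Z : T -> R) (x : R) : R :=
  #|[set w in W | Z w <= x]|%:R / #|W|%:R.
Definition standardize (T : finType) (W : {set T}) (Z : T -> R) : T -> R :=
  fun w => (Z w - unif_mean W Z) / Num.sqrt (unif_var W Z).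
End UniformProbability.

Local Open Scope classical_set_scope.
Definition std_normal_cdf (R : realType) (x : R) : R :=
  fine (normal_prob 0 1 `]-oo, x]).

(* Main.v *)
(** Elements of an antichain make pairwise obtuse angles, since an acute pair
    has a root as difference and would be comparable. Any subset [J] of it
    therefore behaves like a simple system: a root that is an integer combination
    of [J], and whose coroot is one of the coroots of [J], has coefficients of a
    constant sign. Hence every coset of the group generated by the reflections in
    [J] contains an element positive on [J], and averages over these cosets of
    functions of the signs [w(v)], [v] in the subsystem of [J], are constant.
    Mutually orthogonal parts of the antichain thus give uncorrelated statistics.

    Right multiplication of [w] by [s_b], [b] in the antichain, flips [X_b] and
    only affects the [X_g] with [g] not orthogonal to [b], of which there are at
    most five by positivity of the inner product. The resulting exchange identity
    [4 E((Y - EY) F(Y)) = sum_b E((1 - 2 X_b) (F(Y o s_b) - F(Y)))] feeds Stein's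
    method; a first application, to an arctangent, gives concentration of [Y] at
    scale one, and a second one, to the solution of Stein's equation, the
    Berry-Esseen bound. The variance is at least [n / 20]: by a computation in
    rank two the covariance of [X_b] and [X_g] is at least a fifth of the cosine of
    their angle, and the Gram matrix of the antichain is positive. *)

Require Import Defs.
From HB Require Import structures.
From mathcomp Require Import all_boot all_order all_algebra all_fingroup.
From mathcomp Require Import all_classical all_reals all_analysis.
From mathcomp Require Import ring lra.
From Stdlib Require Import Relations.
Set Implicit Arguments. Unset Strict Implicit. Unset Printing Implicit Defensive.
Import Order.TTheory GRing.Theory Num.Theory numFieldNormedType.Exports.
Local Open Scope ring_scope.

(** * Gaussian tails and Stein's equation *)

Section GaussianTail.
Local Open Scope classical_set_scope.
Context {R : realType}.
Implicit Types x y z w t : R.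

Local Notation pdf := (@normal_pdf R 0 1).
Local Notation Phi := (@std_normal_cdf R).

Lemma std_normal_pdfE x : pdf x = normal_peak 1 * expR (- (x ^+ 2 / 2)).
Proof.
rewrite normal_pdfE ?oner_eq0// /normal_fun subr0 expr1n; congr (_ * expR _).
by rewrite mulNr.
Qed.

Lemma std_normal_pdf_gt0 x : 0 < pdf x.
Proof. by rewrite std_normal_pdfE mulr_gt0 ?expR_gt0 ?normal_peak_gt0 ?oner_eq0. Qed.

Lemma std_normal_pdfN x : pdf (- x) = pdf x.
Proof. by rewrite !std_normal_pdfE sqrrN. Qed.

Lemma is_derive_std_normal_pdf x : is_derive x 1 (pdf : R -> R) (- x * pdf x).
Proof.
have dq : is_derive x 1 (fun y : R => - (y ^+ 2 / 2)) (- x).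
  by apply: is_derive_eq; rewrite /GRing.scale /=; field.
have de := @is_derive1_comp _ expR (fun y : R => - (y ^+ 2 / 2)) x _ _ (is_derive_expR _) dq.
have -> : (pdf : R -> R) = normal_peak 1 \*: (expR \o (fun y => - (y ^+ 2 / 2))).
  by apply/funext => y; exact: std_normal_pdfE.
apply: is_derive_eq.
change (normal_peak 1 * (expR (- (x ^+ 2 / 2)) * - x)
  = - x * (normal_peak 1 * expR (- (x ^+ 2 / 2)))); ring.
Qed.

(** The identity seen as a random variable, through which the limits of [cdf] at infinity apply to
    [std_normal_cdf]. *)
Let idTR : measurableTypeR R -> R := idfun.

#[local] HB.instance Definition _ :=
  @isMeasurableFun.Build _ _ _ _ idTR (@measurable_id _ _ setT).

Lemma std_normal_cdf_cdf x :
  (Phi x)%:E = cdf (idTR : {RV (normal_prob 0 1 : probability (measurableTypeR R) R) >-> R}) x.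
Proof.
rewrite /std_normal_cdf fineK //.
have : (normal_prob 0 1 : probability (measurableTypeR R) R) `]-oo, x] \is a fin_num.
  exact: fin_num_measure.
by [].
Qed.

Lemma std_normal_cdf_bounds x : 0 <= Phi x <= 1.
Proof. by rewrite -!lee_fin std_normal_cdf_cdf cdf_ge0 cdf_le1. Qed.

Lemma is_derive_std_normal_cdf x : is_derive x 1 (Phi : R -> R) (pdf x).
Proof.
have [||||df ed] := @continuous_FTC1 R (pdf : R -> R) -oo%O x (x + 1).
- by rewrite ltrDl.
- apply: (integrableS _ _ (subsetT _)) => //; exact: integrable_normal_pdf.
- by rewrite /= ltNyr.
- by apply: continuous_normal_pdf; rewrite oner_eq0.
split; first exact: df.
by rewrite -derive1E; exact: ed.
Qed.

Lemma std_normal_cdf_gt (e z : R) : 0 < e -> exists2 x, z <= x & 1 - e < Phi x.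
Proof.
move=> e0; pose P : probability (measurableTypeR R) R := normal_prob 0 1.
have := @cvg_cdfy1 _ _ R P (idTR : {RV P >-> R}).
rewrite -(_ : (EFin \o Phi) = cdf _); last by apply/funext => y; rewrite -std_normal_cdf_cdf.
move=> /fine_cvgP[_] /cvgr_gt /(_ (1 - e)).
rewrite ltrBlDr ltrDl => /(_ e0) H.
have [x [zx ex]] := filter_ex (filterI (nbhs_pinfty_ge (num_real z)) H).
by exists x.
Qed.

Lemma std_normal_cdf_lt (e z : R) : 0 < e -> exists2 x, z <= x & Phi (- x) < e.
Proof.
move=> e0; pose P : probability (measurableTypeR R) R := normal_prob 0 1.
have := @cvg_cdfNy0 _ _ R P (idTR : {RV P >-> R}).
rewrite -(_ : (EFin \o Phi) = cdf _); last by apply/funext => y; rewrite -std_normal_cdf_cdf.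
move=> /fine_cvgP[_] /cvgr_lt /(_ e e0) H.
have [x [zx ex]] := filter_ex (filterI (nbhs_ninfty_le (num_real (- z))) H).
by exists (- x); rewrite ?opprK // lerNr.
Qed.

Lemma is_derive_invr y : y != 0 -> is_derive y 1 (fun y : R => y^-1) (- y ^- 2).
Proof.
move=> y0; have h : derivable (id : R -> R) y 1 by exact: derivable_id.
split; first exact: (@derivableV _ _ id).
by rewrite (@deriveV _ _ id)// derive_id /GRing.scale /= mulr1.
Qed.

Lemma mvt_le (f df : R -> R) (a b : R) : a <= b ->
  (forall x, a <= x <= b -> is_derive x 1 f (df x)) ->
  exists2 c, a <= c <= b & f b - f a = df c * (b - a).
Proof.
move=> ab dfx.
have [x xI||c cI e] := @MVT_segment R f df a b ab.
- by apply: dfx; rewrite !ltW ?(itvP xI).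
- apply: derivable_within_continuous => x; rewrite in_itv => /= xI.
  by have [] := dfx x xI.
by exists c => //; move: cI; rewrite in_itv.
Qed.

(** The function [T y - pdf y / y] has derivative [pdf y / y^2], so it is nondecreasing for [y > 0];
    a positive value at [x] would make it exceed [T] itself far out, where [T] is tiny. An abstract
    tail [T] serves both ends of the line. *)
Lemma gaussian_mills (T : R -> R) :
  (forall x, is_derive x 1 T (- pdf x)) ->
  (forall e z, 0 < e -> exists2 x, z <= x & T x < e) ->
  forall x, 0 < x -> x * T x <= pdf x.
Proof.
move=> dT T0 x x0; rewrite leNgt; apply/negP => lt.
pose m := T - (pdf : R -> R) * (fun y => y^-1).
have dm y : 0 < y -> is_derive y 1 m (pdf y / y ^+ 2).
  move=> y0; have dp := is_derive_std_normal_pdf y; have dTy := dT y.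
  have dV := @is_derive_invr y (lt0r_neq0 y0).
  apply: is_derive_eq; rewrite /GRing.scale /=; field.
  by rewrite gt_eqF.
have mx : 0 < m x.
  rewrite [m x](_ : _ = T x - pdf x * x^-1)// subr_gt0 ltr_pdivrMr// mulrC//.
have [y xy Ty] := T0 (m x) x mx.
have [c cI e] := @mvt_le m (fun y => pdf y / y ^+ 2) x y xy
  (fun u uI => dm u (lt_le_trans x0 (proj1 (andP uI)))).
have y0 : 0 < y := lt_le_trans x0 xy.
have : 0 <= m y - m x.
  by rewrite e mulr_ge0 ?subr_ge0// divr_ge0 ?sqr_ge0// ltW ?std_normal_pdf_gt0.
rewrite subr_ge0 => /(lt_le_trans Ty).
move=> h2; have : pdf y * y^-1 < 0.
  by move: h2; rewrite [m y](_ : _ = T y - pdf y * y^-1)//; lra.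
by rewrite ltNge mulr_ge0// ?invr_ge0 ?(ltW y0)// ltW// std_normal_pdf_gt0.
Qed.

Lemma mills_right x : 0 < x -> x * (1 - Phi x) <= pdf x.
Proof.
move=> x0; apply: (@gaussian_mills (fun y => 1 - Phi y)) => // [y|e z e0].
  have dP := is_derive_std_normal_cdf y.
  have dB : is_derive y 1 (cst (1 : R) - (Phi : R -> R)) (0 - pdf y).
    exact: is_deriveB.
  by apply: is_derive_eq; rewrite sub0r.
have [y zy ey] := std_normal_cdf_gt z e0; exists y => //; lra.
Qed.

Lemma mills_left x : x < 0 -> - x * Phi x <= pdf x.
Proof.
move=> x0; rewrite -{2}(opprK x) -(std_normal_pdfN x).
apply: (@gaussian_mills (Phi \o -%R)) => [y|e z e0|]; last by rewrite oppr_gt0.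
  have h : is_derive y 1 (-%R : R -> R) (-1) by exact: is_deriveNid.
  have dP := is_derive_std_normal_cdf (- y).
  have dC := @is_derive1_comp _ (Phi : R -> R) -%R y _ _ dP h.
  by apply: is_derive_eq; rewrite std_normal_pdfN mulrN1.
exact: std_normal_cdf_lt.
Qed.

(** * Bounds for the solution of Stein's equation *)

Definition inv_pdf x := (normal_peak (1 : R))^-1 * expR (x ^+ 2 / 2).

Lemma inv_pdfE x : inv_pdf x = (pdf x)^-1.
Proof. by rewrite std_normal_pdfE invfM expRN /inv_pdf (invrK (expR _)). Qed.

Lemma is_derive_inv_pdf x : is_derive x 1 (inv_pdf : R -> R) (x * inv_pdf x).
Proof.
have dq : is_derive x 1 (fun y : R => y ^+ 2 / 2) x.
  by apply: is_derive_eq; rewrite /GRing.scale /=; field.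
have de := @is_derive1_comp _ expR (fun y : R => y ^+ 2 / 2) x _ _ (is_derive_expR _) dq.
have -> : (inv_pdf : R -> R) =
    (normal_peak 1)^-1 \*: (expR \o (fun y => y ^+ 2 / 2)) by [].
apply: is_derive_eq.
change ((normal_peak (1 : R))^-1 * (expR (x ^+ 2 / 2) * x)
  = x * ((normal_peak 1)^-1 * expR (x ^+ 2 / 2))).
ring.
Qed.

(** The Mills ratios of the two Gaussian tails, from which the solution is built on either side of
    its kink. *)
Definition stein_left x := Phi x * inv_pdf x.
Definition stein_right x := (1 - Phi x) * inv_pdf x.

Lemma inv_pdf_gt0 x : 0 < inv_pdf x.
Proof. by rewrite inv_pdfE invr_gt0 std_normal_pdf_gt0. Qed.

Lemma is_derive_stein_left x :
  is_derive x 1 (stein_left : R -> R) (1 + x * stein_left x).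
Proof.
have d1 := is_derive_std_normal_cdf x; have d2 := is_derive_inv_pdf x.
have d3 := @is_deriveM _ _ (Phi : R -> R) (inv_pdf : R -> R) x 1 _ _ d1 d2.
apply: is_derive_eq; rewrite /GRing.scale /= /stein_left inv_pdfE; field.
by rewrite gt_eqF ?std_normal_pdf_gt0.
Qed.

Lemma is_derive_stein_right x :
  is_derive x 1 (stein_right : R -> R) (-1 + x * stein_right x).
Proof.
have dP := is_derive_std_normal_cdf x; have d2 := is_derive_inv_pdf x.
have d1 : is_derive x 1 (cst (1 : R) - (Phi : R -> R)) (- pdf x).
  by apply: is_derive_eq; rewrite sub0r.
have d3 := @is_deriveM _ _ (cst (1 : R) - (Phi : R -> R)) (inv_pdf : R -> R) x 1 _ _ d1 d2.
apply: is_derive_eq; rewrite /GRing.scale /= /stein_right inv_pdfE.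
rewrite [(_ - _ : _ -> _) x](_ : _ = 1 - Phi x)//; field.
by rewrite gt_eqF ?std_normal_pdf_gt0.
Qed.

Lemma stein_left_ge0 x : 0 <= stein_left x.
Proof. by rewrite mulr_ge0 ?(ltW (inv_pdf_gt0 x))//; case/andP: (std_normal_cdf_bounds x). Qed.

Lemma stein_right_ge0 x : 0 <= stein_right x.
Proof.
by rewrite mulr_ge0 ?(ltW (inv_pdf_gt0 x))// subr_ge0; case/andP: (std_normal_cdf_bounds x).
Qed.

Lemma stein_left_mills x : x < 0 -> - x * stein_left x <= 1.
Proof.
move=> x0; rewrite /stein_left mulrA inv_pdfE ler_pdivrMr ?std_normal_pdf_gt0 ?mul1r//.
exact: mills_left.
Qed.

Lemma stein_right_mills x : 0 < x -> x * stein_right x <= 1.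
Proof.
move=> x0; rewrite /stein_right mulrA inv_pdfE ler_pdivrMr ?std_normal_pdf_gt0 ?mul1r//.
exact: mills_right.
Qed.

Lemma std_normal_cdf_le x y : x <= y -> Phi x <= Phi y.
Proof.
move=> xy; have [c _ e] := mvt_le xy (fun u _ => is_derive_std_normal_cdf u).
by rewrite -subr_ge0 e mulr_ge0 ?subr_ge0// ltW ?std_normal_pdf_gt0.
Qed.

(* The bounded solution of [f' w - w f w = 1_{w <= z} - Phi z]; at the kink
   [w = z], [stein_deriv] is its left derivative. *)
Definition stein_sol z w :=
  if w <= z then (1 - Phi z) * stein_left w else Phi z * stein_right w.

Definition stein_deriv z w := w * stein_sol z w + (w <= z)%R%:R - Phi z.

Lemma stein_sol_ge0 z w : 0 <= stein_sol z w.
Proof.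
have := std_normal_cdf_bounds z; have := stein_left_ge0 w; have := stein_right_ge0 w.
rewrite /stein_sol; case: ifP => _ a b /andP[c d]; rewrite mulr_ge0//; lra.
Qed.

(** Monotonicity of [Phi] gives [(1 - Phi z) * Phi w <= 1 - Phi w] when [w <= z]. With the mirror
    image below, both Mills ratios dominate the solution everywhere, so the sign of [w] alone
    decides which one to use. *)
Lemma stein_sol_le_right z w : stein_sol z w <= stein_right w.
Proof.
have := std_normal_cdf_bounds z; have := stein_right_ge0 w => a /andP[c d].
rewrite /stein_sol; case: ifP => wz; last by rewrite ler_piMl.
rewrite /stein_left /stein_right mulrA ler_pM2r ?inv_pdf_gt0//.
have /andP[e f] := std_normal_cdf_bounds w; have g := std_normal_cdf_le wz.
nra.
Qed.

Lemma stein_sol_le_left z w : stein_sol z w <= stein_left w.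
Proof.
have := std_normal_cdf_bounds z; have := stein_left_ge0 w => a /andP[c d].
rewrite /stein_sol; case: ifP => wz; first by rewrite ler_piMl// gerBl.
have {}wz : z <= w by rewrite ltW// ltNge wz.
rewrite /stein_left /stein_right mulrA ler_pM2r ?inv_pdf_gt0//.
have /andP[e f] := std_normal_cdf_bounds w; have g := std_normal_cdf_le wz.
nra.
Qed.

Lemma stein_sol_mul_bound z w : `|w * stein_sol z w| <= 1.
Proof.
have s0 := stein_sol_ge0 z w; have sl := stein_sol_le_left z w; have sr := stein_sol_le_right z w.
have [w0|w0|->] := ltgtP w 0; last by rewrite mul0r normr0.
  rewrite ler0_norm; last by nra.
  by apply: le_trans (stein_left_mills w0); nra.
by rewrite ger0_norm; [apply: le_trans (stein_right_mills w0)|]; nra.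
Qed.

(** For [|w| <= 1] the solution is at most [inv_pdf w], hence [inv_pdf 1]; for larger [|w|],
    [stein_sol_mul_bound] bounds it by one. *)
Definition stein_bound := inv_pdf 1 + 1.

Lemma stein_sol_bound z w : stein_sol z w <= stein_bound.
Proof.
have s0 := stein_sol_ge0 z w; have sl := stein_sol_le_left z w.
have q0 := inv_pdf_gt0 1; rewrite /stein_bound.
have [w1|w1] := leP `|w| 1; last first.
  have := stein_sol_mul_bound z w; rewrite normrM (ger0_norm s0); nra.
have : inv_pdf w <= inv_pdf 1.
  have p0 : 0 < (normal_peak (1 : R))^-1.
    by rewrite invr_gt0; exact/normal_peak_gt0/oner_neq0.
  rewrite /inv_pdf (ler_pM2l p0) ler_expR ler_pM2r ?invr_gt0//.
  by rewrite -(real_normK (num_real w)) expr1n expr_le1.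
have /andP[e f] := std_normal_cdf_bounds w; have q := inv_pdf_gt0 w.
rewrite /stein_left in sl; nra.
Qed.

Lemma stein_deriv_bound z w : `|stein_deriv z w| <= 2.
Proof.
have := stein_sol_mul_bound z w; have /andP[c d] := std_normal_cdf_bounds z.
rewrite /stein_deriv !ler_norml => /andP[a b]; case: (w <= z) => /=; lra.
Qed.

Lemma stein_sol_mvt_left z a b : a <= b -> b <= z ->
  exists2 c, a <= c <= b & stein_sol z b - stein_sol z a = stein_deriv z c * (b - a).
Proof.
move=> ab bz.
have [|c /andP[ac cb] e] := @mvt_le (fun w => (1 - Phi z) * stein_left w)
    (fun w => (1 - Phi z) * (1 + w * stein_left w)) _ _ ab.
  by move=> x _; have := is_derive_stein_left x => h; apply: is_derive_eq.
exists c; first by rewrite ac.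
rewrite /stein_deriv /stein_sol bz (le_trans ab bz) (le_trans cb bz) /=.
by move: e => /= ->; ring.
Qed.

Lemma stein_sol_mvt_right z a b : a <= b -> z < a ->
  exists2 c, a <= c <= b & stein_sol z b - stein_sol z a = stein_deriv z c * (b - a).
Proof.
move=> ab za.
have [|c /andP[ac cb] e] := @mvt_le (fun w => Phi z * stein_right w)
    (fun w => Phi z * (- 1 + w * stein_right w)) _ _ ab.
  by move=> x _; have := is_derive_stein_right x => h; apply: is_derive_eq.
exists c; first by rewrite ac.
have h x : a <= x -> (x <= z) = false by move=> ax; rewrite leNgt (lt_le_trans za ax).
rewrite /stein_deriv /stein_sol !h//=.
by move: e => /= ->; ring.
Qed.

Lemma stein_sol_lipschitz z a b : `|stein_sol z a - stein_sol z b| <= 2 * `|a - b|.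
Proof.
wlog ab : a b / a <= b => [H|].
  have [/H//|/ltW/H] := leP a b.
  by rewrite distrC => h; rewrite (distrC a b).
have aux c u v : `|stein_deriv z c * (u - v)| <= 2 * `|u - v|.
  by rewrite normrM ler_wpM2r// stein_deriv_bound.
rewrite distrC (distrC a).
have [bz|zb] := leP b z; first by have [c _ ->] := stein_sol_mvt_left ab bz.
have [az|za] := leP a z; last by have [c _ ->] := stein_sol_mvt_right ab za.
have [c _ e] := stein_sol_mvt_left az (lexx z).
have [|d /andP[zd _] e'] := @mvt_le (fun w => Phi z * stein_right w)
    (fun w => Phi z * (- 1 + w * stein_right w)) _ _ (ltW zb).
  by move=> x _; have := is_derive_stein_right x => h; apply: is_derive_eq.
have ez : stein_sol z z = Phi z * stein_right z.
  by rewrite /stein_sol lexx /stein_left /stein_right; ring.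
have eb : stein_sol z b = Phi z * stein_right b by rewrite /stein_sol leNgt zb.
(* At [d = z] the right derivative differs by one from [stein_deriv z z], which is the left one;
   that case is bounded directly. *)
have d2 : `|Phi z * (- 1 + d * stein_right d)| <= 2.
  have /andP[p0 p1] := std_normal_cdf_bounds z.
  have [dz|dz] := leP d z.
    have -> : d = z by apply/eqP; rewrite eq_le dz.
    have := stein_sol_mul_bound z z; rewrite ez !ler_norml => /andP[a1 a2].
    by apply/andP; split; nra.
  have := stein_deriv_bound z d; rewrite /stein_deriv /stein_sol (leNgt d) dz /=.
  by rewrite addr0 -mulrCA mulrDr mulrN1 addrC.
have -> : stein_sol z b - stein_sol z a =
  stein_deriv z c * (z - a) + Phi z * (- 1 + d * stein_right d) * (b - z).
  by rewrite -e -e' eb ez; ring.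
apply: le_trans (ler_normD _ _) _.
have -> : `|b - a| = `|z - a| + `|b - z|.
  by rewrite !ger0_norm ?subr_ge0 ?(ltW zb)//; ring.
by rewrite (mulrDr 2) lerD// normrM ler_wpM2r.
Qed.

(** The derivative is [w * stein_sol z w] plus a jump at [z]. The first part varies by at most
    [|t| (stein_bound + 2 |w|)] over the step; the jump matters only when [w] lies within [|t|] of
    [z], an event left to the concentration bound. *)
Lemma stein_sol_taylor z w t :
  `|stein_sol z (w + t) - stein_sol z w - t * stein_deriv z w|
    <= t ^+ 2 * (stein_bound + 2 * `|w|) + 4 * `|t| * (`|w - z| <= `|t|)%R%:R.
Proof.
have near c : `|c - w| <= `|t| ->
    `|c * stein_sol z c - w * stein_sol z w| <= `|t| * (stein_bound + 2 * `|w|).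
  move=> ct.
  have -> : c * stein_sol z c - w * stein_sol z w
    = (c - w) * stein_sol z c + w * (stein_sol z c - stein_sol z w) by ring.
  apply: le_trans (ler_normD _ _) _; rewrite !normrM mulrDr.
  have l := stein_sol_lipschitz z c w.
  rewrite (ger0_norm (stein_sol_ge0 _ _)).
  have b := stein_sol_bound z c; have b0 := stein_sol_ge0 z c.
  have w0 := normr_ge0 w; have cw := normr_ge0 (c - w).
  apply: lerD; first exact: ler_pM.
  by nra.
have same c : (c <= z) = (w <= z) -> `|c - w| <= `|t| ->
    `|t * stein_deriv z c - t * stein_deriv z w| <= t ^+ 2 * (stein_bound + 2 * `|w|).
  move=> cz ct; rewrite -mulrBr normrM -(real_normK (num_real t)) expr2 -mulrA.
  apply: ler_wpM2l => //; rewrite /stein_deriv cz.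
  by rewrite (_ : _ - _ = c * stein_sol z c - w * stein_sol z w) ?near//; ring.
have rhs0 : 0 <= 4 * `|t| * (`|w - z| <= `|t|)%R%:R by rewrite !mulr_ge0.
have split_case : (w + t <= z) != (w <= z) -> `|w - z| <= `|t|.
  by case: (leP (w + t) z); case: (leP w z) => // a b _; rewrite ler_norml;
    have := ler_norm t; have := ler_norm (- t); rewrite normrN; lra.
have [e|ne] := eqVneq (w + t <= z) (w <= z); last first.
  (* When the step crosses the kink, the Lipschitz bound and the bound on the derivative contribute
     [2 |t|] each. *)
  rewrite split_case// mulr1; apply: le_trans (_ : 4 * `|t| <= _); last first.
    by rewrite lerDr mulr_ge0 ?sqr_ge0// addr_ge0 ?mulr_ge0// /stein_bound addr_ge0 ?(ltW (inv_pdf_gt0 _)).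
  apply: le_trans (ler_normB _ _) _.
  have l := stein_sol_lipschitz z (w + t) w; rewrite [w + t - w]addrC addKr in l.
  have := stein_deriv_bound z w; have := normr_ge0 t; rewrite normrM; nra.
suff [c [ce ct ->]] : exists c, [/\ (c <= z) = (w <= z), `|c - w| <= `|t| &
    stein_sol z (w + t) - stein_sol z w = t * stein_deriv z c].
  by apply: le_trans (same _ ce ct) _; rewrite lerDl.
have [t0|/ltW t0] := leP 0 t.
  have wt : w <= w + t by rewrite lerDl.
  have [c /andP[c1 c2] e2] : exists2 c, w <= c <= w + t &
      stein_sol z (w + t) - stein_sol z w = stein_deriv z c * (w + t - w).
    have [h|h] := leP (w + t) z; first exact: stein_sol_mvt_left.
    by apply: stein_sol_mvt_right => //; rewrite ltNge -e -ltNge.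
  exists c; split; last by rewrite e2; ring.
    by apply/idP/idP => [|h]; [exact: le_trans|apply: le_trans c2 _; rewrite e].
  by rewrite !ger0_norm ?subr_ge0//; lra.
have wt : w + t <= w by rewrite gerDl.
have [c /andP[c1 c2] e2] : exists2 c, w + t <= c <= w &
    stein_sol z w - stein_sol z (w + t) = stein_deriv z c * (w - (w + t)).
  have [h|h] := leP w z; first exact: stein_sol_mvt_left.
  by apply: stein_sol_mvt_right => //; rewrite ltNge e -ltNge.
exists c; split; last by rewrite -opprB e2; ring.
  by apply/idP/idP => [h|]; [rewrite -e; apply: le_trans c1 _|exact: le_trans].
by rewrite !ler0_norm ?subr_le0//; lra.
Qed.
End GaussianTail.

(** * A Berry-Esseen bound from sign-flipping involutions *)

Section UniformMean.
Context {R : realType} {T : finType} (W : {set T}).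
Implicit Types F G : T -> R.
Local Notation E := (@unif_mean R T W).

Lemma mean_eq F G : {in W, F =1 G} -> E F = E G.
Proof. by move=> FG; rewrite /unif_mean (eq_bigr _ FG). Qed.

Lemma meanD F G : E (fun w => F w + G w) = E F + E G.
Proof. by rewrite /unif_mean big_split mulrDl. Qed.

Lemma meanZ a F : E (fun w => a * F w) = a * E F.
Proof. by rewrite /unif_mean -mulr_sumr mulrA. Qed.

Lemma meanN F : E (fun w => - F w) = - E F.
Proof. by rewrite /unif_mean sumrN mulNr. Qed.

Lemma meanB F G : E (fun w => F w - G w) = E F - E G.
Proof. by rewrite meanD meanN. Qed.

Lemma mean_sum (I : finType) (J : {set I}) (F : I -> T -> R) :
  E (fun w => \sum_(i in J) F i w) = \sum_(i in J) E (F i).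
Proof. by rewrite /unif_mean exchange_big mulr_suml. Qed.

Lemma mean_le F G : {in W, forall w, F w <= G w} -> E F <= E G.
Proof. by move=> FG; rewrite ler_wpM2r// ler_sum. Qed.

Lemma mean_ge0 F : {in W, forall w, 0 <= F w} -> 0 <= E F.
Proof. by move=> F0; rewrite divr_ge0// sumr_ge0. Qed.

Lemma mean_norm F : `|E F| <= E (fun w => `|F w|).
Proof.
by rewrite /unif_mean normrM (ger0_norm (_ : 0 <= _^-1))// ler_wpM2r// ler_norm_sum.
Qed.

Lemma mean_cst a : (0 < #|W|)%N -> E (fun=> a) = a.
Proof.
by move=> W0; rewrite /unif_mean sumr_const -[a *+ _]mulr_natr mulfK// pnatr_eq0 -lt0n.
Qed.

Lemma mean_comp F (s : T -> T) : injective s -> {in W, forall w, s w \in W} ->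
  E (F \o s) = E F.
Proof.
move=> si sW; rewrite /unif_mean; congr (_ / _).
have eW : s @: W = W.
  apply/eqP; rewrite eqEcard card_imset// leqnn andbT.
  by apply/fintype.subsetP => _ /imsetP[w wW ->]; exact: sW.
by rewrite -{2}eW big_imset//; move=> x y _ _; exact: si.
Qed.

Lemma cdf_mean F x : unif_cdf W F x = E (fun w => (F w <= x)%R%:R).
Proof.
rewrite /unif_cdf /unif_mean; congr (_ / _).
rewrite -sum1_card natr_sum big_mkcond /= [RHS]big_mkcond /=.
by apply: eq_bigr => w _; rewrite inE; case: (w \in W) => //=; case: (F w <= x).
Qed.

(** The form to which the exchange identity applies, with [F] itself as test function. *)
Lemma var_mean F : (0 < #|W|)%N ->
  unif_var W F = E (fun w => (F w - E F) * F w).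
Proof.
move=> W0; rewrite /unif_var.
have -> : E (fun w => (F w - E F) ^+ 2) =
    E (fun w => (F w - E F) * F w - E F * (F w - E F)).
  by apply: mean_eq => w _; rewrite expr2 mulrBr; ring.
by rewrite meanB meanZ meanB mean_cst// subrr mulr0 subr0.
Qed.

Lemma mean_norm_le1 F : (0 < #|W|)%N -> E (fun w => F w ^+ 2) <= 1 ->
  E (fun w => `|F w|) <= 1.
Proof.
move=> W0 F1; apply: le_trans (_ : E (fun w => 2^-1 * (F w ^+ 2 + 1)) <= 1).
  apply: mean_le => w _; rewrite -(real_normK (num_real (F w))).
  have := sqr_ge0 (`|F w| - 1); nra.
by rewrite meanZ meanD mean_cst//; lra.
Qed.

Lemma var_sum (I : finType) (J : {set I}) (F : I -> T -> R) : (0 < #|W|)%N ->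
  unif_var W (fun w => \sum_(i in J) F i w) =
  \sum_(i in J) \sum_(j in J) (E (fun w => F i w * F j w) - E (F i) * E (F j)).
Proof.
move=> W0; rewrite var_mean// mean_sum.
transitivity (\sum_(i in J) E (fun w => (F i w - E (F i)) * \sum_(j in J) F j w)).
  rewrite -[RHS]mean_sum; apply: mean_eq => w _.
  by rewrite -sumrB mulr_suml.
apply: eq_bigr => i _.
under mean_eq do rewrite mulr_sumr.
rewrite mean_sum; apply: eq_bigr => j _.
under mean_eq do rewrite mulrBl.
by rewrite meanB meanZ.
Qed.

Lemma mean_cov_bound (F G : T -> R) (b : R) : (0 < #|W|)%N ->
  {in W, forall w, `|F w| <= b} -> {in W, forall w, `|G w| <= b} ->
  E (fun w => F w * G w) - E F * E G <= 2 * b ^+ 2.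
Proof.
move=> W0 Fb Gb.
have mb (H : T -> R) c : {in W, forall w, `|H w| <= c} -> `|E H| <= c.
  move=> Hc; apply: le_trans (mean_norm _) _; rewrite -[leRHS](mean_cst _ W0).
  exact: mean_le.
have h1 : `|E (fun w => F w * G w)| <= b ^+ 2.
  by apply: mb => w wW; rewrite normrM expr2 ler_pM ?Fb ?Gb.
have h2 : `|E F * E G| <= b ^+ 2 by rewrite normrM expr2 ler_pM ?mb.
by apply: le_trans (ler_norm _) _; apply: le_trans (ler_normB _ _) _; lra.
Qed.

End UniformMean.

(* Union bound: all the translates [w |-> P (g * w)] have the same mean. *)
Lemma mean_cover {R : realType} (gT : finGroupType) (H : {group gT}) (P : gT -> bool) (L : seq gT) :
  {subset L <= H} -> {in H, forall w, exists2 g, g \in L & P (g * w)%g} ->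
  1 <= (size L)%:R * unif_mean H (fun w => (P w)%:R) :> R.
Proof.
move=> LH cov.
have eP g : g \in L -> unif_mean H (fun w => (P (g * w)%g)%:R) = unif_mean H (fun w => (P w)%:R) :> R.
  move=> gL; rewrite /unif_mean [in RHS](reindex_inj (mulgI g)) /=; congr (_ / _).
  by apply: eq_bigl => w; rewrite groupMl// LH.
have -> : (size L)%:R * unif_mean H (fun w => (P w)%:R)
  = unif_mean H (fun w => \sum_(g <- L) (P (g * w)%g)%:R) :> R.
  rewrite [RHS]/unif_mean exchange_big mulr_suml mulr_natl.
  rewrite (eq_big_seq (fun=> unif_mean H (fun w => (P w)%:R))); last by move=> g /eP.
  by rewrite big_const_seq count_predT iter_addr_0.
rewrite -[leLHS](@mean_cst R gT H 1) ?cardG_gt0//.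
rewrite ler_wpM2r// ler_sum// => w wH; have [g gL Pg] := cov w wH.
by rewrite (big_rem g)//= Pg lerDl sumr_ge0.
Qed.

(** * Smooth test functions for the concentration bound *)

Lemma mvt_at {R : realType} (f df : R -> R) (w t : R) :
  (forall x : R, is_derive x 1 f (df x)) ->
  exists2 c, `|c - w| <= `|t| & f (w + t) - f w = df c * t.
Proof.
move=> dfx; have [t0|/ltW t0] := leP 0 t.
  have wt : w <= w + t by rewrite lerDl.
  have [c /andP[c1 c2] e] := mvt_le wt (fun u _ => dfx u); exists c.
    by rewrite !ger0_norm ?subr_ge0//; lra.
  by rewrite e; ring.
have wt : w + t <= w by rewrite gerDl.
have [c /andP[c1 c2] e] := mvt_le wt (fun u _ => dfx u); exists c.
  by rewrite !ler0_norm ?subr_le0//; lra.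
by rewrite -opprB e; ring.
Qed.

(** Since [|u + v| <= 2 |v| + 1 <= 2 (1 + v^2)], the error is relative to the value at [u]; an
    absolute error could not be absorbed later. *)
Lemma inv_1sqr_diff {R : realType} (u v : R) : `|v - u| <= 1 ->
  `|(1 + v ^+ 2)^-1 - (1 + u ^+ 2)^-1| <= 2 * `|v - u| * (1 + u ^+ 2)^-1.
Proof.
move=> vu; have hu : 0 < 1 + u ^+ 2 by rewrite ltr_wpDr ?sqr_ge0.
have hv : 0 < 1 + v ^+ 2 by rewrite ltr_wpDr ?sqr_ge0.
have -> : (1 + v ^+ 2)^-1 - (1 + u ^+ 2)^-1
   = (v - u) * (- (u + v) * (1 + v ^+ 2)^-1) * (1 + u ^+ 2)^-1.
  by field; rewrite !gt_eqF.
have hu' : 0 < (1 + u ^+ 2)^-1 by rewrite invr_gt0.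
have hv' : 0 < (1 + v ^+ 2)^-1 by rewrite invr_gt0.
rewrite !normrM (gtr0_norm hu') (gtr0_norm hv') ler_pM2r// mulrC ler_wpM2r//.
rewrite ler_pdivrMr// normrN.
have -> : u + v = 2 * v - (v - u) by ring.
apply: le_trans (ler_normB _ _) _; rewrite normrM (ger0_norm (_ : 0 <= 2))//.
rewrite -(real_normK (num_real v)); have := sqr_ge0 (`|v| - 1); nra.
Qed.

(* [catan] is a bounded test function whose derivative [cauchy_bump] varies by a
   factor close to one over steps much smaller than [L]: the Taylor error can then
   be absorbed in the main term of Stein's identity. *)
Definition catan {R : realType} (L z w : R) := L * atan ((w - z) / L).
Definition cauchy_bump {R : realType} (L z w : R) := (1 + ((w - z) / L) ^+ 2)^-1.

Lemma is_derive_catan {R : realType} (L z w : R) : L != 0 ->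
  is_derive w 1 (catan L z : R -> R) (cauchy_bump L z w).
Proof.
move=> L0.
have dq : is_derive w 1 (fun y : R => (y - z) / L) (L^-1).
  by apply: is_derive_eq; rewrite /GRing.scale /=; field.
have da := @is_derive1_comp _ atan (fun y : R => (y - z) / L) w _ _ (is_derive1_atan _) dq.
have -> : (catan L z : R -> R) = L \*: (atan \o (fun y => (y - z) / L)) by [].
by apply: is_derive_eq; rewrite /GRing.scale /= mulrC mulfVK.
Qed.

Lemma catan_taylor {R : realType} (L z w t : R) : 0 < L -> `|t| <= L ->
  `|catan L z (w + t) - catan L z w - t * cauchy_bump L z w|
   <= 2 * t ^+ 2 / L * cauchy_bump L z w.
Proof.
move=> L0 tL.
have [c ct ->] := mvt_at w t (fun x => is_derive_catan z x (lt0r_neq0 L0)).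
have Li : 0 < L^-1 by rewrite invr_gt0.
have e : (c - z) / L - (w - z) / L = (c - w) / L by ring.
have e1 : `|(c - z) / L - (w - z) / L| <= `|t| / L.
  by rewrite e normrM (gtr0_norm Li) ler_pM2r.
have h := @inv_1sqr_diff R ((w - z) / L) ((c - z) / L).
rewrite mulrC -mulrBr normrM.
apply: le_trans (ler_wpM2l (normr_ge0 t) (h _)) _.
  by apply: le_trans e1 _; rewrite ler_pdivrMr// mul1r.
rewrite -(real_normK (num_real t)) /cauchy_bump.
have b0 : 0 < (1 + ((w - z) / L) ^+ 2)^-1 by rewrite invr_gt0 ltr_wpDr ?sqr_ge0.
rewrite mulrA ler_pM2r// -mulrA expr2 mulrCA [X in _ <= X](_ : _ = 2 * (`|t| * (`|t| / L))); last by ring.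
by rewrite ler_pM2l// ler_wpM2l.
Qed.

Lemma cauchy_bump_ge0 {R : realType} (L z w : R) : 0 <= cauchy_bump L z w.
Proof. by rewrite invr_ge0 addr_ge0// sqr_ge0. Qed.

Lemma cauchy_bump_le1 {R : realType} (L z w : R) : cauchy_bump L z w <= 1.
Proof. by rewrite invf_le1 ?ltr_wpDr ?sqr_ge0// lerDl sqr_ge0. Qed.

Lemma cauchy_bump_near {R : realType} (L z w : R) : 0 < L -> `|w - z| <= L ->
  2^-1 <= cauchy_bump L z w.
Proof.
move=> L0 h; rewrite lef_pV2 ?posrE ?ltr_wpDr ?sqr_ge0//.
rewrite -[2]/(1 + 1) lerD2l -(real_normK (num_real _)) normrM.
by rewrite expr_le1 ?mulr_ge0// normfV (gtr0_norm L0) ler_pdivrMr ?mul1r.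
Qed.

Lemma catan_bound {R : realType} (L z w : R) : 0 < L -> `|catan L z w| <= 2 * L.
Proof.
move=> L0; rewrite normrM (gtr0_norm L0) mulrC ler_pM2r//.
have := atan_gtNpi2 ((w - z) / L); have := atan_ltpi2 ((w - z) / L).
have : pi / 2 <= 2 :> R by have := @pihalf_lt2 R; lra.
by rewrite ler_norml; lra.
Qed.

(* The involutions [s i] flip the sign variable [X i]; summing the resulting
   exchange identities over [i] is a discrete integration by parts, in which
   [G / (4 sigma^2)] plays the role of a Stein coefficient. *)
Section FlipBerryEsseen.
Context {R : realType} {T I : finType} (W : {set T}) (J : {set I}).
Variables (X : I -> T -> bool) (s : I -> T -> T) (B V c : R).
Hypotheses (W0 : (0 < #|W|)%N) (J0 : (0 < #|J|)%N).
Hypothesis sK : forall i, i \in J -> involutive (s i).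
Hypothesis sW : forall i, i \in J -> {in W, forall w, s i w \in W}.
Hypothesis sX : forall i, i \in J -> {in W, forall w, X i (s i w) = ~~ X i w}.
Hypotheses (c0 : 0 < c) (B0 : 0 < B) (V0 : 0 <= V).

Local Notation E := (@unif_mean R T W).
Local Notation n := (#|J|%:R : R).
Let Y (w : T) : R := (\sum_(i in J) X i w)%N%:R.
Let sgn i (w : T) : R := 1 - 2 * (X i w)%:R.
Let G (w : T) : R := \sum_(i in J) sgn i w * (Y (s i w) - Y w).

Hypothesis YB : forall i, i \in J -> {in W, forall w, `|Y (s i w) - Y w| <= B}.
Hypothesis varG : unif_var W G <= V * n.
Hypothesis varY : c * n <= unif_var W Y.

Let sigma := Num.sqrt (unif_var W Y).
Let Z := standardize W Y.

Lemma flip_norm i w : `|sgn i w| = 1.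
Proof.
rewrite /sgn; case: (X i w) => /=; last by rewrite mulr0 subr0 normr1.
by rewrite (_ : 1 - 2 * 1 = -1 :> R) ?normrN1//; ring.
Qed.

(** The substitution [s i] preserves the mean and negates [sgn i], so the right-hand mean is
    [-2 E(sgn i * F)], while [X i - 1/2 = - sgn i / 2]. *)
Lemma flip_exchange i (F : T -> R) : i \in J ->
  E (fun w => ((X i w)%:R - 2^-1) * F w) =
  4^-1 * E (fun w => sgn i w * (F (s i w) - F w)).
Proof.
move=> iJ.
have e : E (fun w => sgn i w * F (s i w)) = E (fun w => - (sgn i w * F w)).
  rewrite -(mean_comp (fun w => - (sgn i w * F w)) (inv_inj (sK iJ)) (sW iJ)).
  by apply: mean_eq => w wW /=; rewrite /sgn sX//; case: (X i w) => /=; ring.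
under [in RHS]mean_eq do rewrite mulrBr.
rewrite meanB e -meanB -meanZ; apply: mean_eq => w _.
by rewrite /sgn; field.
Qed.

Lemma flip_mean1 i : i \in J -> E (fun w => (X i w)%:R) = 2^-1.
Proof.
move=> iJ; have := flip_exchange (fun=> 1) iJ.
under mean_eq do rewrite mulr1.
rewrite meanB mean_cst// => /eqP; rewrite subr_eq => /eqP ->.
under mean_eq do rewrite subrr mulr0.
by rewrite mean_cst// mulr0 add0r.
Qed.

Lemma flip_mean : E Y = n / 2.
Proof.
rewrite -(mean_eq (F := fun w => \sum_(i in J) (X i w)%:R)); last first.
  by move=> w _; rewrite /Y natr_sum.
rewrite mean_sum (eq_bigr (fun=> 2^-1)); last by move=> i; exact: flip_mean1.
by rewrite sumr_const -[LHS]mulr_natl.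
Qed.

Lemma flip_by_parts (F : T -> R) :
  E (fun w => (Y w - E Y) * F w) =
  4^-1 * E (fun w => \sum_(i in J) sgn i w * (F (s i w) - F w)).
Proof.
rewrite mean_sum mulr_sumr.
under [RHS]eq_bigr => i iJ do rewrite -flip_exchange//.
rewrite -mean_sum; apply: mean_eq => w _.
rewrite flip_mean -mulr_suml; congr (_ * _).
by rewrite sumrB sumr_const /Y natr_sum -[in RHS](mulr_natl 2^-1).
Qed.

(** The test function is [Y]; consequently the Stein coefficient [G / (4 sigma^2)] has mean one. *)
Lemma flip_meanG : E G = 4 * unif_var W Y.
Proof. by rewrite var_mean// flip_by_parts; field. Qed.

Lemma flip_n_gt0 : 0 < n.
Proof. by rewrite ltr0n. Qed.

Lemma flip_var_gt0 : 0 < unif_var W Y.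
Proof. by apply: lt_le_trans varY; rewrite mulr_gt0// flip_n_gt0. Qed.

Lemma flip_sigma_gt0 : 0 < sigma.
Proof. by rewrite sqrtr_gt0 flip_var_gt0. Qed.

Lemma flip_sigma2 : sigma ^+ 2 = unif_var W Y.
Proof. by rewrite sqr_sqrtr// ltW ?flip_var_gt0. Qed.

Lemma flip_Z2 : E (fun w => Z w ^+ 2) = 1.
Proof.
rewrite -[RHS](divff (lt0r_neq0 flip_var_gt0)) mulrC -meanZ -flip_sigma2.
by apply: mean_eq => w _; rewrite /Z /standardize -/sigma exprMn exprVn mulrC.
Qed.

Lemma flip_absZ : E (fun w => `|Z w|) <= 1.
Proof. by apply: mean_norm_le1 => //; rewrite flip_Z2. Qed.

Let sn := Num.sqrt n.
Let D := (V / (16 * c ^+ 2) + 1) / 2.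

Lemma flip_sn_gt0 : 0 < sn.
Proof. by rewrite sqrtr_gt0 flip_n_gt0. Qed.

Lemma flip_sn2 : sn ^+ 2 = n.
Proof. by rewrite sqr_sqrtr// ltW ?flip_n_gt0. Qed.

(** The weighted inequality [|u| <= (sn * u^2 + 1 / sn) / 2] trades the first moment for the second,
    which is [unif_var W G / (16 sigma^4)], at most of order [1 / n] by [varG] and [varY]. *)
Lemma flip_coef : E (fun w => `|G w / (4 * sigma ^+ 2) - 1|) <= D / sn.
Proof.
have s0 := flip_sigma_gt0; have n0 := flip_n_gt0; have sn0 := flip_sn_gt0.
have v2 : E (fun w => (G w / (4 * sigma ^+ 2) - 1) ^+ 2)
    = unif_var W G / (16 * sigma ^+ 4).
  rewrite /unif_var flip_meanG -flip_sigma2 [RHS]mulrC -meanZ; apply: mean_eq => w _.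
  by field; rewrite gt_eqF.
apply: le_trans (_ : E (fun w =>
   (sn * (G w / (4 * sigma ^+ 2) - 1) ^+ 2 + sn^-1) / 2) <= _).
  apply: mean_le => w _; set u := _ - 1.
  rewrite -(real_normK (num_real u)); move: (`|u|) => a.
  have -> : (sn * a ^+ 2 + sn^-1) / 2 = a + (sn * a - 1) ^+ 2 / (2 * sn).
    by field; rewrite gt_eqF.
  by rewrite lerDl divr_ge0 ?sqr_ge0// mulr_ge0// ltW.
under mean_eq do rewrite mulrC.
rewrite meanZ meanD mean_cst// meanZ v2.
have s4 : c ^+ 2 * n ^+ 2 <= sigma ^+ 4.
  rewrite -exprMn (exprM _ 2 2) lerXn2r ?nnegrE ?sqr_ge0 ?flip_sigma2// ltW// mulr_gt0//.
have : unif_var W G / (16 * sigma ^+ 4) <= V / (16 * c ^+ 2) / n.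
  rewrite ler_pdivrMr ?mulr_gt0 ?exprn_gt0//; apply: le_trans varG _.
  have -> : V * n = V / (16 * c ^+ 2) / n * (16 * (c ^+ 2 * n ^+ 2)).
    by field; rewrite !gt_eqF.
  apply: ler_wpM2l; last by rewrite ler_pM2l.
  by rewrite !divr_ge0// ?mulr_ge0 ?sqr_ge0// ltW.
move=> h; rewrite /D.
have -> : (V / (16 * c ^+ 2) + 1) / 2 / sn
   = 2^-1 * (sn * (V / (16 * c ^+ 2) / n) + sn^-1).
  by rewrite -flip_sn2; field; rewrite !gt_eqF.
by rewrite ler_pM2l ?invr_gt0// lerD2r ler_pM2l.
Qed.

(** Common to both test functions: [g] plays the derivative of [f] and [r] bounds the Taylor
    remainder over one flip. The first error comes from the Stein coefficient differing from one,
    the second from the [n] remainders, each weighted by [1 / (4 sigma)]. *)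
Lemma flip_stein (f g r : R -> R) (M : R) : (forall w, `|g w| <= M) ->
  (forall w t, `|t| <= B / sigma -> `|f (w + t) - f w - t * g w| <= r w) ->
  `|E (fun w => Z w * f (Z w)) - E (fun w => g (Z w))|
    <= M * (D / sn) + n / (4 * sigma) * E (fun w => r (Z w)).
Proof.
move=> gM fr; have s0 := flip_sigma_gt0.
pose t i w := (Y (s i w) - Y w) / sigma.
have Zt i w : Z (s i w) = Z w + t i w.
  by rewrite /Z /standardize -/sigma /t; ring.
have e1 : E (fun w => Z w * f (Z w)) =
  E (fun w => (4 * sigma)^-1 * \sum_(i in J) sgn i w * (f (Z (s i w)) - f (Z w))).
  rewrite meanZ invfM [4^-1 * _]mulrC -mulrA -(flip_by_parts (f \o Z)) -meanZ.
  by apply: mean_eq => w _ /=; move: (f (Z w)) => F; rewrite /Z /standardize -/sigma; ring.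
pose rho w := (4 * sigma)^-1 *
  \sum_(i in J) sgn i w * (f (Z w + t i w) - f (Z w) - t i w * g (Z w)).
have e2 w : (4 * sigma)^-1 * (\sum_(i in J) sgn i w * (f (Z (s i w)) - f (Z w)))
    = g (Z w) + g (Z w) * (G w / (4 * sigma ^+ 2) - 1) + rho w.
  have -> : g (Z w) + g (Z w) * (G w / (4 * sigma ^+ 2) - 1) + rho w
     = (4 * sigma)^-1 * (\sum_(i in J) sgn i w * (t i w * g (Z w))) + rho w.
    have -> : \sum_(i in J) sgn i w * (t i w * g (Z w)) = G w / sigma * g (Z w).
      by rewrite /G 2!mulr_suml; apply: eq_bigr => i _; rewrite /t; ring.
    by congr (_ + _); field; rewrite gt_eqF.
  rewrite -mulrDr -big_split /=; congr (_ * _).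
  by apply: eq_bigr => i _; rewrite Zt; ring.
rewrite e1 (mean_eq (G := fun w => g (Z w) + (g (Z w) * (G w / (4 * sigma ^+ 2) - 1) + rho w))); last first.
  by move=> w _; rewrite e2 addrA.
rewrite meanD addrAC subrr add0r; apply: le_trans (mean_norm _ _) _.
apply: le_trans (_ : E (fun w => M * `|G w / (4 * sigma ^+ 2) - 1| + n / (4 * sigma) * r (Z w)) <= _).
  apply: mean_le => w wW; apply: le_trans (ler_normD _ _) _; apply: lerD.
    by rewrite normrM ler_wpM2r.
  rewrite /rho normrM ger0_norm ?invr_ge0 ?mulr_ge0 ?(ltW s0)//.
  rewrite mulrAC [X in _ <= X]mulrC ler_wpM2l ?invr_ge0 ?mulr_ge0 ?(ltW s0)//.
  apply: le_trans (ler_norm_sum _ _ _) _.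
  rewrite mulr_natl -sumr_const; apply: ler_sum => i iJ.
  rewrite normrM flip_norm mul1r; apply: fr.
  have s0' : 0 < sigma^-1 by rewrite invr_gt0.
  by rewrite normrM (gtr0_norm s0') ler_pM2r// YB.
rewrite meanD !meanZ lerD2r ler_wpM2l// ?flip_coef//.
exact: le_trans (normr_ge0 _) (gM 0).
Qed.

(** The scale at which the remainder term of [flip_stein] for [catan] is exactly half of the mean of
    [cauchy_bump]; by [flip_L_ub] it is at most of order [1 / sn]. *)
Let L := n * B ^+ 2 / sigma ^+ 3.

(** [G] has mean [4 sigma^2] and is a sum of [n] terms bounded by [B]. This makes a single flip no
    longer than [L]. *)
Lemma flip_var_ub : 4 * sigma ^+ 2 <= n * B.
Proof.
rewrite flip_sigma2 -flip_meanG -(mean_cst (n * B) W0); apply: mean_le => w wW.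
rewrite mulr_natl -sumr_const; apply: ler_sum => i iJ.
by apply: le_trans (ler_norm _) _; rewrite normrM flip_norm mul1r YB.
Qed.

Lemma flip_sigma_lb : Num.sqrt c * sn <= sigma.
Proof. by rewrite /sn -sqrtrM ?(ltW c0)// /sigma ler_wsqrtr. Qed.

Lemma flip_L_ub : L <= B ^+ 2 / (c * Num.sqrt c) / sn.
Proof.
have s0 := flip_sigma_gt0; have n0 := flip_n_gt0; have sn0 := flip_sn_gt0.
have q0 : 0 < Num.sqrt c by rewrite sqrtr_gt0.
rewrite /L ler_pdivrMr ?exprn_gt0//.
have -> : n * B ^+ 2 = B ^+ 2 / (c * Num.sqrt c) / sn * (c * n * (Num.sqrt c * sn)).
  by field; rewrite !gt_eqF.
apply: ler_wpM2l; first by rewrite !divr_ge0 ?sqr_ge0 ?mulr_ge0// ltW.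
rewrite exprSr; apply: ler_pM; rewrite ?flip_sigma_lb ?flip_sigma2//.
- by rewrite mulr_ge0// ltW.
- by rewrite mulr_ge0// ltW.
Qed.

Lemma flip_L_gt0 : 0 < L.
Proof.
by rewrite divr_gt0 ?mulr_gt0 ?exprn_gt0// ?flip_sigma_gt0 ?flip_n_gt0.
Qed.

Lemma flip_step_le : B / sigma <= L.
Proof.
have s0 := flip_sigma_gt0; have u := flip_var_ub; rewrite /L.
have -> : B / sigma = sigma ^+ 2 * B / sigma ^+ 3 by field; rewrite gt_eqF.
rewrite ler_pM2r ?invr_gt0 ?exprn_gt0// expr2 (expr2 B) mulrA ler_pM2r// -expr2.
by have := sqr_ge0 sigma; lra.
Qed.

(** Let [b] be the mean of the bump. Stein's identity for [catan] gives [b <= 2 L + D / sn + b / 2],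
    and the indicator is at most twice the bump because [B / sigma <= L]. *)
Lemma flip_concentration z :
  E (fun w => (`|Z w - z| <= B / sigma)%R%:R) <= 8 * L + 4 * (D / sn).
Proof.
have s0 := flip_sigma_gt0; have L0 := flip_L_gt0; have n0 := flip_n_gt0.
set b := E (fun w => cauchy_bump L z (Z w)).
have h := @flip_stein (catan L z) (cauchy_bump L z)
  (fun w => 2 * (B / sigma) ^+ 2 / L * cauchy_bump L z w) 1 _ _.
have {h} : `|E (fun w => Z w * catan L z (Z w)) - b| <= 1 * (D / sn) + 2^-1 * b.
  apply: le_trans (h _ _) _.
  - by move=> w; rewrite ger0_norm ?cauchy_bump_ge0 ?cauchy_bump_le1.
  - move=> w t tB; apply: le_trans (catan_taylor _ _ L0 (le_trans tB flip_step_le)) _.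
    rewrite ler_wpM2r ?cauchy_bump_ge0// ler_pM2r ?invr_gt0// ler_pM2l//.
    by rewrite -(real_normK (num_real t)) lerXn2r ?nnegrE// divr_ge0// ltW.
  rewrite meanZ lerD2l mulrA -/b ler_wpM2r//.
    by apply: mean_ge0 => w _; exact: cauchy_bump_ge0.
  by rewrite /L le_eqVlt; apply/orP; left; apply/eqP; field; rewrite !gt_eqF.
have : `|E (fun w => Z w * catan L z (Z w))| <= 2 * L.
  apply: le_trans (mean_norm _ _) _; rewrite -[X in _ <= X]mulr1.
  apply: le_trans (_ : E (fun w => 2 * L * `|Z w|) <= _).
    apply: mean_le => w _; rewrite normrM mulrC ler_wpM2r//.
    exact: catan_bound.
  by rewrite meanZ ler_wpM2l ?flip_absZ// mulr_ge0// ltW.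
have hb : E (fun w => (`|Z w - z| <= B / sigma)%R%:R) <= 2 * b.
  rewrite -meanZ; apply: mean_le => w _.
  have [h|h] := leP `|Z w - z| (B / sigma) => /=.
    by have := cauchy_bump_near L0 (le_trans h flip_step_le); lra.
  by rewrite mulr_ge0// cauchy_bump_ge0.
rewrite !ler_norml => /andP[h1 h2] /andP[h3 h4].
by move: hb h1 h2 h3 h4; move: (D / sn) b (E _) (E _) => *; lra.
Qed.

Let K := stein_bound : R.

(** Stein's equation turns the discrepancy at [x] into the left side of [flip_stein]; the kink term
    of the Taylor remainder is averaged by [flip_concentration]. *)
Lemma flip_kolmogorov x : `|unif_cdf W Z x - std_normal_cdf x| <=
  2 * (D / sn) + (L * (K + 2) / 4 + B / c * (8 * L + 4 * (D / sn))).
Proof.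
have s0 := flip_sigma_gt0; have L0 := flip_L_gt0; have n0 := flip_n_gt0.
have -> : unif_cdf W Z x - std_normal_cdf x =
   - (E (fun w => Z w * stein_sol x (Z w)) - E (fun w => stein_deriv x (Z w))).
  rewrite cdf_mean -(mean_cst (std_normal_cdf x) W0) -!meanB.
  by rewrite -meanN; apply: mean_eq => w _; rewrite /stein_deriv; ring.
rewrite normrN.
apply: le_trans (@flip_stein (stein_sol x) (stein_deriv x)
  (fun w => (B / sigma) ^+ 2 * (K + 2 * `|w|) +
    4 * (B / sigma) * (`|w - x| <= B / sigma)%R%:R) 2 _ _) _.
- exact: stein_deriv_bound.
- move=> w t tB; apply: le_trans (stein_sol_taylor x w t) _.
  have b0 : 0 <= B / sigma by rewrite divr_ge0// ltW.
  apply: lerD.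
    apply: ler_wpM2r.
      by rewrite addr_ge0 ?mulr_ge0// /K /stein_bound addr_ge0// ltW ?inv_pdf_gt0.
    by rewrite -(real_normK (num_real t)) lerXn2r ?nnegrE.
  apply: ler_pM => //.
    by rewrite ler_pM2l.
  by rewrite ler_nat; case: leP => // h; rewrite (le_trans h tB).
rewrite lerD2l meanD !meanZ meanD mean_cst// meanZ.
have h1 := flip_concentration x; have h2 := flip_absZ.
set p := E _ in h1 *; set q := E _ in h2 *.
have -> : n / (4 * sigma) * ((B / sigma) ^+ 2 * (K + 2 * q) + 4 * (B / sigma) * p)
   = L * (K + 2 * q) / 4 + n * B / sigma ^+ 2 * p.
  by rewrite /L; field; rewrite gt_eqF.
apply: lerD.
  rewrite ler_pM2r ?invr_gt0// ler_pM2l//; lra.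
have p0 : 0 <= p by apply: mean_ge0.
(* The lower bound on the variance turns [n * B / sigma^2] into [B / c]. *)
apply: ler_pM => //; first by rewrite divr_ge0 ?mulr_ge0 ?sqr_ge0// ltW.
rewrite ler_pdivrMr ?exprn_gt0// mulrAC ler_pdivlMr// flip_sigma2.
by rewrite [X in X <= _](_ : _ = B * (c * n)) ?ler_pM2l//; ring.
Qed.

Definition flip_constant := 2 * D + (B ^+ 2 / (c * Num.sqrt c) * (K + 2) / 4 +
   B / c * (8 * (B ^+ 2 / (c * Num.sqrt c)) + 4 * D)).

Lemma flip_berry_esseen x :
  `|unif_cdf W Z x - std_normal_cdf x| <= flip_constant * sn^-1.
Proof.
apply: le_trans (flip_kolmogorov x) _.
have l := flip_L_ub; have bc : 0 < B / c by rewrite divr_gt0.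
have k0 : 0 <= (K + 2) / 4.
  by rewrite divr_ge0 ?addr_ge0// ltW ?inv_pdf_gt0.
set L0 := B ^+ 2 / _ in l *; rewrite /flip_constant -/L0.
have -> : (2 * D + (L0 * (K + 2) / 4 + B / c * (8 * L0 + 4 * D))) * sn^-1 =
  2 * (D / sn) + (L0 / sn * ((K + 2) / 4) + B / c * (8 * (L0 / sn) + 4 * (D / sn))).
  by ring.
rewrite lerD2l; apply: lerD; first by rewrite -mulrA ler_wpM2r.
by rewrite ler_pM2l// lerD2r ler_pM2l.
Qed.

End FlipBerryEsseen.

(** * Root systems and subsystems with obtuse generators *)

Section RootSystem.
Context {R : realType} {d : nat}.
Local Notation V := 'rV[R]_d.
Implicit Types (u v x y : V) (a b g : V).

Lemma dotvE u v : dotv u v = \sum_j u 0 j * v 0 j.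
Proof. by rewrite /dotv mxE; apply: eq_bigr => j _; rewrite mxE. Qed.

Lemma dotvC u v : dotv u v = dotv v u.
Proof. by rewrite !dotvE; apply: eq_bigr => j _; rewrite mulrC. Qed.

Lemma dotvDl u v x : dotv (u + v) x = dotv u x + dotv v x.
Proof. by rewrite /dotv mulmxDl mxE. Qed.

Lemma dotvZl c u x : dotv (c *: u) x = c * dotv u x.
Proof. by rewrite /dotv -scalemxAl mxE. Qed.

Lemma dotvNl u x : dotv (- u) x = - dotv u x.
Proof. by rewrite -scaleN1r dotvZl mulN1r. Qed.

Lemma dotvBl u v x : dotv (u - v) x = dotv u x - dotv v x.
Proof. by rewrite dotvDl dotvNl. Qed.

Lemma dotv0l x : dotv 0 x = 0.
Proof. by rewrite -(scale0r 0) dotvZl mul0r. Qed.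

Lemma dotvDr u v x : dotv x (u + v) = dotv x u + dotv x v.
Proof. by rewrite !(dotvC x) dotvDl. Qed.

Lemma dotvZr c u x : dotv x (c *: u) = c * dotv x u.
Proof. by rewrite !(dotvC x) dotvZl. Qed.

Lemma dotvNr u x : dotv x (- u) = - dotv x u.
Proof. by rewrite !(dotvC x) dotvNl. Qed.

Definition dotv_lin := (dotvDl, dotvDr, dotvNl, dotvNr, dotvZl, dotvZr).

Lemma dotv_suml (I : Type) (r : seq I) (P : pred I) (F : I -> V) x :
  dotv (\sum_(i <- r | P i) F i) x = \sum_(i <- r | P i) dotv (F i) x.
Proof.
elim/big_rec2: _ => [|i y1 y2 _ IH]; first by rewrite dotv0l.
by rewrite dotvDl IH.
Qed.

Lemma dotv_sumr (I : Type) (r : seq I) (P : pred I) (F : I -> V) x :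
  dotv x (\sum_(i <- r | P i) F i) = \sum_(i <- r | P i) dotv x (F i).
Proof. by rewrite dotvC dotv_suml; apply: eq_bigr => i _; rewrite dotvC. Qed.

Lemma dotv_ge0 u : 0 <= dotv u u.
Proof. by rewrite dotvE sumr_ge0// => j _; rewrite -expr2 sqr_ge0. Qed.

Lemma dotv_eq0 u : (dotv u u == 0) = (u == 0).
Proof.
apply/eqP/eqP => [|->]; last exact: dotv0l.
rewrite dotvE => /eqP; rewrite psumr_eq0 => [/allP h|j _]; last by rewrite -expr2 sqr_ge0.
apply/rowP => j; rewrite mxE; apply/eqP.
by have := h j (mem_index_enum j); rewrite mulf_eq0 orbb.
Qed.

Lemma dotv_gt0 u : (0 < dotv u u) = (u != 0).
Proof. by rewrite lt0r dotv_ge0 andbT dotv_eq0. Qed.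

Definition cartan b a : R := 2 * dotv b a / dotv a a.

Lemma reflE a b : refl a b = b - cartan b a *: a.
Proof. by []. Qed.

Lemma dotv_refl a x y : a != 0 -> dotv (refl a x) (refl a y) = dotv x y.
Proof.
rewrite -dotv_gt0 => a0; rewrite !reflE /cartan !dotv_lin (dotvC a y).
by field; rewrite gt_eqF.
Qed.

Lemma reflZD a c x y : refl a (c *: x + y) = c *: refl a x + refl a y.
Proof.
rewrite !reflE /cartan !dotv_lin scalerBr scalerA [RHS]addrACA -opprD -scalerDl.
by congr (_ - _ *: _); ring.
Qed.

Lemma reflD a x y : refl a (x + y) = refl a x + refl a y.
Proof. by have := reflZD a 1 x y; rewrite !scale1r. Qed.

Lemma reflZ a c x : refl a (c *: x) = c *: refl a x.
Proof.
rewrite -[c *: x]addr0 reflZD -[RHS]addr0; congr (_ + _).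
by rewrite reflE /cartan dotv0l mulr0 mul0r scale0r subr0.
Qed.

Lemma cartan_self a : a != 0 -> cartan a a = 2.
Proof. by rewrite -dotv_gt0 => a0; rewrite /cartan mulfK// gt_eqF. Qed.

Lemma refl_self a : a != 0 -> refl a a = - a.
Proof.
by move=> a0; rewrite reflE cartan_self// scaler_nat mulr2n opprD addrA subrr sub0r.
Qed.

Lemma reflK a x : a != 0 -> refl a (refl a x) = x.
Proof.
move=> a0; rewrite [refl a x]reflE reflD -scaleNr reflZ refl_self// scalerN scaleNr opprK.
by rewrite reflE subrK.
Qed.

Lemma cartan_refl a x : a != 0 -> cartan (refl a x) a = - cartan x a.
Proof.
move=> a0; have := dotv_refl x a a0; rewrite refl_self// dotvNr => /eqP.
by rewrite eqr_oppLR => /eqP h; rewrite /cartan h mulrN mulNr.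
Qed.

Lemma refl_refl a b x : a != 0 ->
  refl (refl a b) x = refl a (refl b (refl a x)).
Proof.
move=> a0; rewrite (reflE b) reflD -scaleNr reflZ reflK// scaleNr reflE.
by rewrite /cartan dotv_refl// -{2}(reflK x a0) dotv_refl.
Qed.

Lemma refl_orth a x : dotv x a = 0 -> refl a x = x.
Proof. by move=> xa; rewrite reflE /cartan xa mulr0 mul0r scale0r subr0. Qed.

(** * Heights and the root poset *)

Variables Phi Delta : seq V.
Hypothesis crys : crystallographic_root_system Phi.
Hypothesis simp : simple_system Phi Delta.

Lemma root_neq0 a : a \in Phi -> a != 0.
Proof. by case: crys => _ h _ _ _; apply: contraTneq => ->. Qed.

Lemma root_sqr_gt0 a : a \in Phi -> 0 < dotv a a.
Proof. by move/root_neq0; rewrite dotv_gt0. Qed.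

Lemma root_refl a b : a \in Phi -> b \in Phi -> refl a b \in Phi.
Proof. by case: crys => _ _ h _ _; exact: h. Qed.

Lemma root_opp a : a \in Phi -> - a \in Phi.
Proof. by move=> h; rewrite -refl_self ?root_neq0// root_refl. Qed.

Lemma root_cartan a b : a \in Phi -> b \in Phi -> cartan b a \is a Num.int.
Proof. by case: crys => _ _ _ h _; exact: h. Qed.

Lemma cartanM a b : a \in Phi -> b \in Phi ->
  cartan b a * dotv a a = cartan a b * dotv b b.
Proof.
move=> /root_sqr_gt0 a0 /root_sqr_gt0 b0.
by rewrite /cartan !divfK ?gt_eqF// dotvC.
Qed.

Lemma int_gt0_ge1 (z : R) : z \is a Num.int -> 0 < z -> 1 <= z.
Proof. by move=> /intrP[m ->]; rewrite ltr0z ler1z gtz0_ge1. Qed.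

Lemma cartan_gt0 a b : a \in Phi -> (0 < cartan b a) = (0 < dotv b a).
Proof.
move=> /root_sqr_gt0 a0.
by rewrite /cartan pmulr_lgt0 ?invr_gt0// pmulr_rgt0.
Qed.

(** Two Cartan integers at least two would give [|a|^2 <= (a, b)] and [|b|^2 <= (a, b)], hence
    [|a - b|^2 <= 0]. *)
Lemma acute_cartan a b : a \in Phi -> b \in Phi -> a != b -> 0 < dotv a b ->
  cartan a b = 1 \/ cartan b a = 1.
Proof.
move=> aP bP ab dab; have a0 := root_sqr_gt0 aP; have b0 := root_sqr_gt0 bP.
have h1 := root_cartan bP aP; have h2 := root_cartan aP bP.
have p1 : 0 < cartan a b by rewrite cartan_gt0.
have p2 : 0 < cartan b a by rewrite cartan_gt0// dotvC.
have ge2 (z : R) : z \is a Num.int -> 0 < z -> z != 1 -> 2 <= z.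
  case/intrP=> m -> q0 q1; move: q0; rewrite ltr0z; case: m q1 => [[|[|m]]|m] // q1 _.
    by move: q1; rewrite eqxx.
  by rewrite -[_%:~R]/(m.+2%:R) ler_nat.
have [|n1] := eqVneq (cartan a b) 1; first by left.
have [|n2] := eqVneq (cartan b a) 1; first by right.
have k1 := ge2 _ h1 p1 n1; have k2 := ge2 _ h2 p2 n2.
have e1 : cartan a b * dotv b b = 2 * dotv a b by rewrite /cartan divfK ?gt_eqF.
have e2 : cartan b a * dotv a a = 2 * dotv a b by rewrite /cartan divfK ?gt_eqF// dotvC.
have : 0 < dotv (a - b) (a - b) by rewrite dotv_gt0 subr_eq0.
by rewrite !dotv_lin (dotvC b a); nra.
Qed.

Lemma root_sub a b : a \in Phi -> b \in Phi -> a != b -> 0 < dotv a b -> a - b \in Phi.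
Proof.
move=> aP bP ab dab; case: (acute_cartan aP bP ab dab) => e.
  by have := root_refl bP aP; rewrite reflE e scale1r.
by rewrite -opprB root_opp//; have := root_refl aP bP; rewrite reflE e scale1r.
Qed.

(** Built from coordinates, this is a linear form on the whole space, and its sign on a root decides
    positivity. *)
Definition height v : R := \sum_(i < size Delta) coord (in_tuple Delta) i v.

Lemma heightD u v : height (u + v) = height u + height v.
Proof. by rewrite /height -big_split; apply: eq_bigr => i _; rewrite linearD. Qed.

Lemma heightZ c u : height (c *: u) = c * height u.
Proof. by rewrite /height mulr_sumr; apply: eq_bigr => i _; rewrite linearZ. Qed.

Lemma heightN u : height (- u) = - height u.
Proof. by rewrite -scaleN1r heightZ mulN1r. Qed.

Lemma heightB u v : height (u - v) = height u - height v.
Proof. by rewrite heightD heightN. Qed.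

Lemma height0 : height 0 = 0.
Proof. by rewrite -(scale0r 0) heightZ mul0r. Qed.

Lemma height_sum (I : Type) (r : seq I) (P : pred I) (F : I -> V) :
  height (\sum_(i <- r | P i) F i) = \sum_(i <- r | P i) height (F i).
Proof.
elim/big_rec2: _ => [|i y1 y2 _ IH]; first by rewrite height0.
by rewrite heightD IH.
Qed.

Lemma coord_comb (c : 'I_(size Delta) -> R) i :
  coord (in_tuple Delta) i (\sum_(j < size Delta) c j *: Delta`_j) = c i.
Proof.
case: simp => _ fr _; rewrite linear_sum /= (bigD1 i)//= big1 ?addr0 => [|j ji].
  by rewrite linearZ /= (@coord_free _ _ _ (in_tuple Delta) i i fr) eqxx mulr1.
by rewrite linearZ /= (@coord_free _ _ _ (in_tuple Delta) j i fr) (negbTE ji) mulr0.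
Qed.

Lemma height_comb (c : 'I_(size Delta) -> R) :
  height (\sum_(j < size Delta) c j *: Delta`_j) = \sum_j c j.
Proof. by apply: eq_bigr => i _; rewrite coord_comb. Qed.

Lemma simple_nth (i : 'I_(size Delta)) : Delta`_i \in Delta.
Proof. exact: mem_nth. Qed.

Lemma simple_root a : a \in Delta -> a \in Phi.
Proof. by case: simp => h _ _; exact: h. Qed.

Lemma height_simple a : a \in Delta -> height a = 1.
Proof.
case/(nthP 0) => k ks <-; rewrite (_ : Delta`_k = \sum_(j < size Delta)
  (j == Ordinal ks)%:R *: Delta`_j); last first.
  rewrite (bigD1 (Ordinal ks))//= eqxx scale1r big1 ?addr0// => j /negbTE ->.
  by rewrite scale0r.
rewrite height_comb (bigD1 (Ordinal ks))//= eqxx big1 ?addr0// => j /negbTE ->.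
by [].
Qed.

Lemma comb_height b : b != 0 -> nonneg_int_comb Delta b -> 0 < height b.
Proof.
move=> b0 [c e]; rewrite e height_comb lt0r sumr_ge0 ?andbT//.
apply: contra b0; rewrite psumr_eq0// => /allP h; apply/eqP; rewrite e.
apply: big1 => i _; have /eqP := h i (mem_index_enum i).
by move=> /= ->; rewrite scale0r.
Qed.

Lemma root_height b : b \in Phi -> height b != 0.
Proof.
move=> bP; have b0 := root_neq0 bP; case: simp => _ _ h; case: (h b bP) => /comb_height.
  by move=> /(_ b0)/gt_eqF/negbT.
by rewrite oppr_eq0 heightN oppr_gt0 => /(_ b0)/lt_eqF/negbT.
Qed.

Lemma positive_rootE b : b \in Phi -> positive_root Phi Delta b <-> 0 < height b.
Proof.
move=> bP; split=> [[_]|h]; first exact/comb_height/root_neq0.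
split=> //; case: simp => _ _ /(_ b bP)[//|/comb_height].
by rewrite oppr_eq0 root_neq0// heightN oppr_gt0 => /(_ isT)/(lt_trans h); rewrite ltxx.
Qed.

Lemma negative_rootE b : b \in Phi -> is_negative_root Phi Delta b = (height b < 0).
Proof.
move=> bP; have h := positive_rootE (root_opp bP); rewrite heightN oppr_gt0 in h.
by apply/asboolP/idP => /h.
Qed.

(** Otherwise [|v|^2], expanded along the combination, would be a sum of nonpositive terms. *)
Lemma comb_acute (c : 'I_(size Delta) -> nat) v :
  v = \sum_(i < size Delta) (c i)%:R *: Delta`_i -> v != 0 ->
  exists2 i, (0 < c i)%N & 0 < dotv v Delta`_i.
Proof.
move=> e v0; have [/existsP[i /andP[? ?]]|] :=
    boolP [exists i, (0 < c i)%N && (0 < dotv v Delta`_i)]; first by exists i.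
rewrite negb_exists => /forallP h; move: v0; rewrite -dotv_gt0 {2}e dotv_sumr.
rewrite ltNge sumr_le0// => i _; rewrite dotvZr; have := h i.
by rewrite negb_and -leqNgt leqn0 -leNgt => /orP[/eqP->|h']; rewrite ?mul0r// mulr_ge0_le0.
Qed.

Lemma comb_sub1 (c : 'I_(size Delta) -> nat) i : (0 < c i)%N ->
  nonneg_int_comb Delta ((\sum_(j < size Delta) (c j)%:R *: Delta`_j) - Delta`_i).
Proof.
move=> ci; exists (fun j => (c j - (j == i))%N).
rewrite (bigD1 i)//= [RHS](bigD1 i)//= eqxx natrB// scalerBl scale1r addrAC.
by congr (_ + _); apply: eq_bigr => j /negbTE ->; rewrite subn0.
Qed.

(** The order is generated by covers, so a chain has to be built: a simple root occurring in [b - g]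
    and acute to it is subtracted from [b] or added to [g], by induction on the height of the
    difference. *)
Lemma root_le_comb b g : positive_root Phi Delta b -> positive_root Phi Delta g ->
  nonneg_int_comb Delta (b - g) -> root_le Phi Delta g b.
Proof.
have [N] : exists N : nat, height (b - g) < N%:R.
  exists (Num.bound `|height (b - g)|); apply: le_lt_trans (ler_norm _) _.
  exact: archi_boundP.
elim: N b g => [|N IH] b g hN pb pg cbg.
  have [e|ne] := eqVneq (b - g) 0; last by have := lt_trans hN (comb_height ne cbg); rewrite ltxx.
  by rewrite (subr0_eq e); exact: rt_refl.
have [bP hb] : b \in Phi /\ 0 < height b by case: (pb) => bP _; split=> //; apply/positive_rootE.
have [gP hg] : g \in Phi /\ 0 < height g by case: (pg) => gP _; split=> //; apply/positive_rootE.
have [e|ne] := eqVneq (b - g) 0; first by rewrite (subr0_eq e); exact: rt_refl.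
have [c ec] := cbg; have [i ci di] := comb_acute ec ne.
set al := Delta`_i in di; have aD : al \in Delta := simple_nth i.
have aP := simple_root aD; have ha := height_simple aD.
have cs := comb_sub1 ci; rewrite -ec -/al in cs.
have kge1 : 1 <= height (b - g).
  have := heightD (b - g - al) al; rewrite subrK ha => ->; rewrite lerDr.
  have [->|n0] := eqVneq (b - g - al) 0; first by rewrite height0.
  exact/ltW/comb_height.
(* As [(b - g, al) > 0], either [(b, al) > 0] and [b - al] is a root, or [(g, al) < 0] and [g + al]
   is one. *)
have [da|da] := ltP 0 (dotv b al).
  have ba : b != al by apply/eqP => e; rewrite heightB e ha in kge1; lra.
  have bs := root_sub bP aP ba da.
  have pbs : positive_root Phi Delta (b - al).
    by apply/positive_rootE => //; rewrite heightB ha; rewrite heightB in kge1; lra.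
  apply: (@rt_trans _ _ _ (b - al)).
    apply: IH => //; last by rewrite addrAC.
    by rewrite addrAC heightB ha; move: hN; rewrite -natr1; lra.
  by apply: rt_step; split=> //; rewrite opprB addrC subrK.
have dg : 0 < dotv g (- al) by rewrite dotvNr; rewrite dotvBl in di; lra.
have ga : g != - al by apply/eqP => e; rewrite e heightN ha in hg; lra.
have gs := root_sub gP (root_opp aP) ga dg; rewrite opprK in gs.
have pgs : positive_root Phi Delta (g + al).
  by apply/positive_rootE => //; rewrite heightD ha; lra.
apply: (@rt_trans _ _ _ (g + al)).
  by apply: rt_step; split=> //; rewrite addrC addKr.
apply: IH => //; last by rewrite opprD addrA.
by rewrite opprD addrA heightB ha; move: hN; rewrite -natr1; lra.
Qed.

(** * The Weyl group as permutations of the roots *)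

Local Notation root := (seq_sub Phi).
Implicit Types (w : {perm root}) (J : {set root}).

Lemma rootP (i : root) : val i \in Phi.
Proof. exact: valP. Qed.

Definition srefl a : {perm root} := perm_of_fun (@refl_fun _ _ Phi a).

Lemma srefl_val a (i : root) : a \in Phi -> val (srefl a i) = refl a (val i).
Proof.
move=> aP.
have fE (j : root) : val (refl_fun a j) = refl a (val j).
  by rewrite /refl_fun insubT ?root_refl ?rootP.
have fI : injective (@refl_fun _ _ Phi a).
  move=> j k e; apply: val_inj; have := congr1 val e; rewrite !fE => /(congr1 (refl a)).
  by rewrite !reflK ?root_neq0.
rewrite /srefl /perm_of_fun; case: {-}_ / idP => [H|[]]; last exact/injectiveP.
by rewrite permE fE.
Qed.

Local Notation W := (weyl_group Phi Delta).

Lemma srefl_simple a : a \in Delta -> srefl a \in W.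
Proof.
move=> aD; apply: mem_gen; apply/imsetP.
by exists (SeqSub (simple_root aD)); rewrite ?inE.
Qed.

(** Induction on the height of a positive [a]: a simple [al] acute to [a] gives the lower positive
    root [b = refl al a], and the reflection in [a] is that in [b] conjugated by that in [al]. *)
Lemma srefl_weyl a : a \in Phi -> srefl a \in W.
Proof.
wlog : a / 0 < height a => [H aP|].
  have [/H|] := ltP 0 (height a); first exact.
  rewrite le_eqVlt (negbTE (root_height aP)) /= => ha.
  suff -> : srefl a = srefl (- a) by apply: H; rewrite ?heightN ?oppr_gt0 ?root_opp.
  apply/permP => i; apply: val_inj; rewrite !srefl_val ?root_opp//.
  by rewrite !reflE /cartan !dotv_lin opprK mulrN mulNr scaleNr scalerN opprK.
have [N] : exists N : nat, height a < N%:R.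
  exists (Num.bound `|height a|); apply: le_lt_trans (ler_norm _) _.
  exact: archi_boundP.
elim: N a => [|N IH] a hN h0 aP; first by have := lt_trans hN h0; rewrite ltxx.
have [_ [c ec]] := (positive_rootE aP).2 h0.
have [i ci di] := comb_acute ec (root_neq0 aP).
set al := Delta`_i in di; have aD : al \in Delta := simple_nth i.
have alP := simple_root aD; have ha := height_simple aD.
have [->|ne] := eqVneq a al; first exact: srefl_simple.
set b := refl al a; have bP : b \in Phi by exact: root_refl.
have b0 : 0 < height b.
  (* Reflecting in [al] changes only the coefficient of [al], so a negative [b] would force the
     other coefficients of [a] to vanish; [a] would be a nonnegative multiple of [al], hence
     [al]. *)
  case: ltP => // bn; exfalso.
  have [_ [cb eb]] : positive_root Phi Delta (- b).
    apply/positive_rootE; rewrite ?root_opp// heightN oppr_gt0 lt_neqAle bn andbT.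
    exact: root_height.
  have cz j : j != i -> c j = 0%N.
    move=> ji; have := coord_comb (fun j => (cb j)%:R) j.
    rewrite -eb linearN /= /b reflE linearB linearZ /= {1}ec coord_comb.
    rewrite (@coord_free _ _ _ (in_tuple Delta) i j); last by case: simp.
    rewrite eq_sym (negbTE ji) mulr0 subr0 => /eqP; rewrite eqr_oppLR -mulrN1.
    rewrite mulrN1 => /eqP h; apply/eqP; rewrite -(@pnatr_eq0 R) eq_le ler0n andbT.
    by rewrite h oppr_le0.
  have ea : a = (c i)%:R *: al.
    by rewrite {1}ec (bigD1 i)//= big1 ?addr0// => j ji; rewrite cz// scale0r.
  have := aP; rewrite {1}ea; case: crys => _ _ _ _ h5 /(h5 al _ alP)[] h.
    by move: ne; rewrite ea h scale1r eqxx.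
  by have := ler0n R (c i); rewrite h; lra.
have -> : srefl a = (srefl al * srefl b * srefl al)%g.
  apply/permP => j; apply: val_inj; rewrite !permM !srefl_val//.
  by rewrite -refl_refl ?root_neq0// /b reflK ?root_neq0.
rewrite !groupM ?(srefl_simple aD)//; apply: IH => //.
have : 1 <= cartan a al by rewrite int_gt0_ge1 ?root_cartan// cartan_gt0.
by rewrite /b reflE heightB heightZ ha mulr1; move: hN; rewrite -natr1; lra.
Qed.

Definition lin_fun (f : V -> R) :=
  (forall u v, f (u + v) = f u + f v) /\ (forall c u, f (c *: u) = c * f u).

Lemma lin_fun_sum f (I : Type) (r : seq I) (P : pred I) (F : I -> V) : lin_fun f ->
  f (\sum_(i <- r | P i) F i) = \sum_(i <- r | P i) f (F i).
Proof.
move=> [fD fZ]; elim/big_rec2: _ => [|i y1 y2 _ IH]; first by rewrite -(scale0r 0) fZ mul0r.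
by rewrite fD IH.
Qed.

(** Elements of [W] are mere permutations here; composing [f] with the reflections of a word for [w]
    recovers the linearity of the action. *)
Lemma weyl_linear w f : w \in W -> lin_fun f ->
  exists2 g, lin_fun g & forall i, g (val i) = f (val (w i)).
Proof.
case/gen_prodgP => n [s hs ->].
elim: n s hs f => [|n IH] s hs f lf.
  by exists f => // i; rewrite big_ord0 perm1.
have [g lg eg] := IH (fun i => s (lift ord0 i)) (fun i => hs _) f lf.
have /imsetP[x] := hs ord0; rewrite inE => xD es.
have xP := rootP x.
exists (g \o refl (val x)) => [|i].
  case: lg => gD gZ; split=> [u v|c u] /=; first by rewrite reflD gD.
  by rewrite reflZ gZ.
by rewrite big_ord_recl permM /= es -(srefl_val _ xP) eg.
Qed.

Definition inv_at (i : root) w : bool := height (val (w i)) < 0.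

Lemma X_rootE (i : root) w : X_root Delta i w = inv_at i w.
Proof. by rewrite /X_root negative_rootE ?rootP. Qed.

Lemma height_lin : lin_fun height.
Proof. by split=> *; rewrite ?heightD ?heightZ. Qed.

Lemma weyl_srefl_height w (i j : root) : w \in W ->
  height (val (w (srefl (val j) i))) =
  height (val (w i)) - cartan (val i) (val j) * height (val (w j)).
Proof.
move=> wW; have [g [gD gZ] eg] := weyl_linear wW height_lin.
by rewrite -!eg srefl_val ?rootP// reflE gD -scaleNr gZ mulNr.
Qed.

Lemma inv_at_srefl (i : root) w : w \in W ->
  inv_at i (srefl (val i) * w)%g = ~~ inv_at i w.
Proof.
move=> wW; rewrite /inv_at permM weyl_srefl_height// cartan_self ?root_neq0 ?rootP//.
have := root_height (rootP (w i)); have [h|h|->] := ltgtP (height (val (w i))) 0; last by [].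
  by move=> _; apply/negbTE; rewrite -leNgt; lra.
by move=> _; lra.
Qed.

(** * Subsystems generated by pairwise obtuse positive roots *)

Section ObtuseSubsystem.
Variable J : {set root}.
Hypothesis Jpos : forall i, i \in J -> 0 < height (val i).
Hypothesis Jobt : forall i j, i \in J -> j \in J -> i != j -> dotv (val i) (val j) <= 0.

(** Split the sum as [vp + vn] by the sign of the coefficients. If the claim failed,
    [(vp + vn, vp) <= 0]; but [(vn, vp) >= 0] by obtuseness, and [vp] is nonzero since its height is
    positive. *)
Lemma obtuse_acute (c : root -> R) :
  (exists2 i, i \in J & 0 < c i) ->
  exists i, [/\ i \in J, 0 < c i & 0 < dotv (\sum_(j in J) c j *: val j) (val i)].
Proof.
case=> i0 i0J ci0; set v := \sum_(j in J) _.
have [/existsP[i /and3P[? ? ?]]|] :=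
  boolP [exists i, [&& i \in J, 0 < c i & 0 < dotv v (val i)]]; first by exists i.
rewrite negb_exists => /forallP h; exfalso.
pose vp := \sum_(j in J | 0 < c j) c j *: val j.
pose vn := \sum_(j in J | ~~ (0 < c j)) c j *: val j.
have ev : v = vp + vn by rewrite /v (bigID (fun j => 0 < c j)).
have vp0 : vp != 0.
  suff : 0 < height vp by apply: contraTneq => ->; rewrite height0 ltxx.
  rewrite height_sum (bigD1 i0) ?i0J//= heightZ.
  rewrite ltr_pwDl ?mulr_gt0 ?Jpos// sumr_ge0// => j /andP[/andP[jJ cj] _].
  by rewrite heightZ mulr_ge0 ?(ltW cj)// ltW ?Jpos.
have h1 : dotv v vp <= 0.
  rewrite dotv_sumr sumr_le0// => j /andP[jJ cj]; rewrite dotvZr.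
  by have := h j; rewrite jJ cj /= -leNgt => hj; rewrite mulr_ge0_le0// ltW.
have h2 : 0 <= dotv vn vp.
  rewrite dotv_suml sumr_ge0// => j /andP[jJ cj]; rewrite dotv_sumr sumr_ge0// => k /andP[kJ ck].
  rewrite dotvZl dotvZr mulr_le0//; first by rewrite leNgt.
  rewrite mulr_ge0_le0 ?(ltW ck)// Jobt//.
  by apply: contraNneq cj => ->.
by move: h1; rewrite ev dotvDl; have := vp0; rewrite -dotv_gt0; lra.
Qed.

Lemma obtuse_free (c : root -> R) : \sum_(j in J) c j *: val j = 0 ->
  {in J, forall i, c i = 0}.
Proof.
move=> e i iJ; have [ci|ci|//] := ltgtP (c i) 0.
  have [|j [_ _]] := @obtuse_acute (fun j => - c j); first by exists i; rewrite ?oppr_gt0.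
  under eq_bigr do rewrite scaleNr.
  by rewrite sumrN e oppr0 dotv0l ltxx.
have [|j [_ _]] := @obtuse_acute c; first by exists i.
by rewrite e dotv0l ltxx.
Qed.

(* The integrality of [c i |psi_i|^2 / |v|^2] says that the coroot of [v] is an
   integer combination of the coroots of [J]. *)
Definition in_subsystem v (c : root -> int) :=
  [/\ v \in Phi, v = \sum_(i in J) (c i)%:~R *: val i &
   {in J, forall i, (c i)%:~R * dotv (val i) (val i) / dotv v v \is a Num.int}].

Lemma sum_sub_single (c : root -> int) (m : int) i : i \in J ->
  \sum_(j in J) (c j - (if j == i then m else 0))%:~R *: val j =
  \sum_(j in J) (c j)%:~R *: val j - m%:~R *: val i.
Proof.
move=> iJ; rewrite (bigD1 i)//= [in RHS](bigD1 i)//= eqxx intrB scalerBl addrAC.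
by congr (_ + _ - _); apply: eq_bigr => j /andP[_ /negbTE ->]; rewrite subr0.
Qed.

Lemma in_subsystem_single i : i \in J -> in_subsystem (val i) (fun j => (j == i)%:Z).
Proof.
move=> iJ; split; first exact: rootP.
  rewrite (bigD1 i)//= eqxx scale1r big1 ?addr0// => j /andP[_ /negbTE ->].
  by rewrite scale0r.
move=> j jJ; have [->|_] := eqVneq j i; last by rewrite !mul0r.
by rewrite mul1r divff ?gt_eqF ?root_sqr_gt0 ?rootP.
Qed.

Lemma in_subsystem_refl v c i : in_subsystem v c -> i \in J ->
  exists2 m : int, m%:~R = cartan v (val i) &
   in_subsystem (refl (val i) v) (fun j => c j - (if j == i then m else 0)).
Proof.
move=> [vP ev ci] iJ; have iP := rootP i.
have /intrP[m em] := root_cartan iP vP; exists m => //; split.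
- exact: root_refl.
- by rewrite sum_sub_single// -ev -em.
move=> j jJ; rewrite dotv_refl ?root_neq0// intrB !mulrBl rpredB ?ci//.
have [->|_] := eqVneq j i; last by rewrite !mul0r rpred0.
rewrite -em (cartanM iP vP) mulfK ?gt_eqF ?root_sqr_gt0//.
exact: root_cartan.
Qed.

(** The difference is [refl (val i) v] or [- refl v (val i)]. In the second case it has the length
    of [val i], and [|v|^2 / |val i|^2] is the Cartan integer [cartan v (val i)], which preserves
    the coroot condition. *)
Lemma in_subsystem_sub v c i : in_subsystem v c -> i \in J -> v != val i ->
  0 < dotv v (val i) ->
  in_subsystem (v - val i) (fun j => c j - (if j == i then 1 else 0)).
Proof.
move=> sv iJ vi dvi; have [vP ev ci] := sv; have iP := rootP i.
have [e|e] := acute_cartan vP iP vi dvi.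
  have [m em] := in_subsystem_refl sv iJ; rewrite reflE -em.
  have -> : m = 1 by apply/eqP; rewrite -(@eqr_int R) em e.
  by rewrite scale1r.
have eq : v - val i = - refl v (val i) by rewrite reflE e scale1r opprB.
split.
- by rewrite eq root_opp// root_refl.
- by rewrite (sum_sub_single _ 1)// -ev scale1r.
move=> j jJ; rewrite eq dotvNl dotvNr opprK dotv_refl ?root_neq0//.
rewrite intrB !mulrBl rpredB//; last first.
  have [->|_] := eqVneq j i; last by rewrite !mul0r rpred0.
  by rewrite mul1r divff ?gt_eqF ?root_sqr_gt0// rpred1.
have -> : (c j)%:~R * dotv (val j) (val j) / dotv (val i) (val i) =
   (c j)%:~R * dotv (val j) (val j) / dotv v v * cartan v (val i).
  have := cartanM iP vP; rewrite e mul1r => <-.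
  have v0 := root_sqr_gt0 vP; have i0 := root_sqr_gt0 iP.
  rewrite invfM.
  have c0 : cartan v (val i) != 0 by rewrite gt_eqF// cartan_gt0.
  by field; rewrite c0 gt_eqF.
by rewrite rpredM ?ci// root_cartan.
Qed.

(** Induction on the sum of the [|c i|]. A mixed [v] is acute to some generator [i] with [c i > 0];
    subtracting it keeps a negative coefficient, so all the new coefficients are nonpositive, whence
    [c i = 1] and the other [c l] are nonpositive. Lengths then give a contradiction. *)
Lemma in_subsystem_unmixed v c : in_subsystem v c ->
  {in J, forall i, 0 <= c i} \/ {in J, forall i, c i <= 0}.
Proof.
have [N] : exists N : nat, (\sum_(i in J) `|c i|%N < N)%N by exists (\sum_(i in J) `|c i|%N).+1.
elim: N v c => [//|N IH] v c hN sv; have [vP ev ci] := sv.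
have [/existsP[k /andP[kJ ck]]|h] := boolP [exists i, (i \in J) && (0 < c i)]; last first.
  right=> i iJ; move: h; rewrite negb_exists => /forallP/(_ i).
  by rewrite iJ /= -leNgt.
have [/existsP[j /andP[jJ cj]]|h] := boolP [exists i, (i \in J) && (c i < 0)]; last first.
  left=> i iJ; move: h; rewrite negb_exists => /forallP/(_ i).
  by rewrite iJ /= -leNgt.
exfalso.
have [|i [iJ ci0 di]] := @obtuse_acute (fun i => (c i)%:~R); first by exists k; rewrite ?ltr0z.
rewrite -ev in di; rewrite ltr0z in ci0.
have ji : j != i by apply: contraTneq cj => ->; rewrite -leNgt ltW.
have vi : v != val i.
  apply/eqP => e; have /obtuse_free/(_ j jJ)/eqP :
     \sum_(j in J) (c j - (if j == i then 1 else 0))%:~R *: val j = 0 :> V.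
    by rewrite sum_sub_single// -ev e scale1r subrr.
  by rewrite (negbTE ji) subr0 intr_eq0 lt_eqF.
have sv' := in_subsystem_sub sv iJ vi di.
have [|h|h] := IH _ _ _ sv'.
- rewrite -ltnS; apply: leq_trans hN; rewrite ltnS.
  rewrite (bigD1 i)//= [X in (_ < X)%N](bigD1 i)//= eqxx -addSn leq_add//.
    by case: (c i) ci0 => // -[|n] // _; rewrite (_ : n.+1%:Z - 1 = n%:Z)// intS addrC addKr.
  by apply: leq_sum => l /andP[_ /negbTE ->]; rewrite subr0.
- by have := h j jJ; rewrite (negbTE ji) subr0 leNgt cj.
have ci1 : c i = 1.
  have := h i iJ; rewrite eqxx subr_le0 => c1; apply/eqP; rewrite eq_le c1.
  by rewrite -gtz0_ge1.
pose nu := \sum_(k in J | k != i) (c k)%:~R *: val k.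
have evn : v = val i + nu by rewrite ev (bigD1 i)//= ci1 scale1r.
have ck0 l : l \in J -> l != i -> c l <= 0.
  by move=> lJ li; have := h l lJ; rewrite (negbTE li) subr0.
have dn : 0 <= dotv (val i) nu.
  rewrite dotv_sumr sumr_ge0// => l /andP[lJ li]; rewrite dotvZr mulr_le0 ?lerz0 ?ck0//.
  by rewrite Jobt// eq_sym.
have nu0 : 0 < dotv nu nu.
  rewrite dotv_gt0; suff : height nu < 0 by apply: contraTneq => ->; rewrite height0 ltxx.
  rewrite height_sum (bigD1 j) ?jJ//= heightZ.
  rewrite ltr_wnDr//; last by rewrite nmulr_rlt0 ?ltrz0 ?Jpos.
  rewrite sumr_le0// => l /andP[/andP[lJ li] _].
  by rewrite heightZ mulr_le0_ge0 ?lerz0 ?ck0// ltW ?Jpos.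
have i0 := root_sqr_gt0 (rootP i); have v0 := root_sqr_gt0 vP.
(* With [c i = 1] the coroot condition makes [|val i|^2 / |v|^2] a positive integer, whereas
   [v = val i + nu] is strictly longer than [val i]. *)
have := int_gt0_ge1 (ci i iJ); rewrite ci1 mul1r => /(_ (divr_gt0 i0 v0)).
rewrite ler_pdivlMr// mul1r evn !dotv_lin (dotvC nu (val i)); lra.
Qed.

Definition subsystem (i : root) := exists c, in_subsystem (val i) c.

Lemma subsystem_sign w w' (i : root) : w \in W -> w' \in W ->
  {in J, forall j, 0 < height (val (w j))} ->
  {in J, forall j, 0 < height (val (w' j))} ->
  subsystem i -> inv_at i w = inv_at i w'.
Proof.
move=> wW wW' wJ wJ' [c sc]; have [_ ev _] := sc.
have aux (u : {perm root}) : u \in W -> {in J, forall j, 0 < height (val (u j))} ->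
    inv_at i u = ~~ [forall j in J, 0 <= c j].
  move=> uW uJ; have [g lg eg] := weyl_linear uW height_lin.
  have hu : height (val (u i)) = \sum_(j in J) (c j)%:~R * height (val (u j)).
    rewrite -eg ev lin_fun_sum//; apply: eq_bigr => j _.
    by case: lg => _ ->; rewrite eg.
  have [/forall_inP h|/forall_inP h] := boolP [forall j in J, 0 <= c j].
    rewrite /inv_at hu ltNge sumr_ge0// => j jJ.
    by rewrite mulr_ge0 ?ler0z ?h// ltW ?uJ.
  have [//|h'] := in_subsystem_unmixed sc.
  rewrite /inv_at lt_neqAle root_height ?rootP// hu sumr_le0// => j jJ.
  by rewrite mulr_le0_ge0 ?lerz0 ?h'// ltW ?uJ.
by rewrite !aux.
Qed.

Definition refl_group : {group {perm root}} := <<[set srefl (val i) | i in J]>>%G.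
Local Notation WJ := refl_group.

Lemma srefl_refl_group i : i \in J -> srefl (val i) \in WJ.
Proof. by move=> iJ; apply: mem_gen; apply: imset_f. Qed.

Lemma refl_group_sub : WJ \subset W.
Proof.
rewrite gen_subG; apply/fintype.subsetP => _ /imsetP[i _ ->].
by apply: srefl_weyl; exact: rootP.
Qed.

Lemma refl_group_ind (P : {perm root} -> Prop) : P 1%g ->
  (forall i (v : {perm root}), i \in J -> P v -> P (srefl (val i) * v)%g) ->
  forall v : {perm root}, v \in WJ -> P v.
Proof.
move=> P1 PM _ /gen_prodgP[n [s hs ->]].
elim: n s hs => [|n IH] s hs; first by rewrite big_ord0.
rewrite big_ord_recl; have /imsetP[i iJ ->] := hs ord0.
by apply: PM => //; apply: IH => j.
Qed.

Lemma subsystem_srefl i j : j \in J -> subsystem i -> subsystem (srefl (val j) i).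
Proof.
move=> jJ [c sc]; have [m _ sm] := in_subsystem_refl sc jJ.
by exists (fun k => c k - (if k == j then m else 0)); rewrite srefl_val ?rootP.
Qed.

Lemma subsystem_mem i : i \in J -> subsystem i.
Proof. by move=> iJ; exists (fun j => (j == i)%:Z); exact: in_subsystem_single. Qed.

Lemma subsystem_refl_group (v : {perm root}) i : v \in WJ -> subsystem i -> subsystem (v i).
Proof.
move=> vW; elim/refl_group_ind: v / vW i => [i|j v jJ IH i si]; first by rewrite perm1.
by rewrite permM; apply/IH/subsystem_srefl.
Qed.

(** Reindexing by the reflection in [j] shows [S = - S + height (val j) * S2] with [S2 > 0]. *)
Lemma sum_height_cartan_gt0 (j : root) : 0 < height (val j) ->
  0 < \sum_(i : root) height (val i) * cartan (val i) (val j).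
Proof.
move=> hj; have jP := rootP j; set S := \sum_(_ : root) _.
pose S2 := \sum_(i : root) cartan (val i) (val j) ^+ 2.
have S20 : 0 < S2.
  rewrite /S2 (bigD1 j)//= ltr_pwDl ?cartan_self ?root_neq0// ?exprn_gt0//.
  by rewrite sumr_ge0// => i _; rewrite sqr_ge0.
have e : S = - S + height (val j) * S2.
  rewrite {1}/S (reindex_inj (@perm_inj _ (srefl (val j)))) /=.
  rewrite /S /S2 mulr_sumr -sumrN -big_split; apply: eq_bigr => i _ /=.
  rewrite srefl_val// cartan_refl ?root_neq0// reflE heightB heightZ; ring.
have := mulr_gt0 hj S20; lra.
Qed.

(* A longest-element argument: [v] maximises a [W]-equivariant pairing. *)
Lemma refl_group_positive w : w \in W -> exists2 v : {perm root}, v \in WJ &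
  {in J, forall j, 0 < height (val ((v * w)%g j))}.
Proof.
move=> wW; pose T (u : {perm root}) := \sum_(i : root) height (val i) * height (val ((u * w)%g i)).
have [v vW vmax] := @arg_maxP _ _ _ (1%g : {perm root}) (mem WJ) T (group1 _).
exists v => // j jJ; have hj := Jpos jJ.
have uW : (v * w)%g \in W by rewrite groupM// (fintype.subsetP refl_group_sub).
have := vmax _ (groupM (srefl_refl_group jJ) vW).
(* Since the last sum is positive, maximality at [v] forces the height of [(v * w) j] to be
   nonnegative, and the height of a root never vanishes. *)
have -> : T (srefl (val j) * v)%g = T v - height (val ((v * w)%g j)) *
    (\sum_(i : root) height (val i) * cartan (val i) (val j)).
  rewrite /T mulr_sumr -sumrB; apply: eq_bigr => i _.
  by rewrite -mulgA (permM (srefl _)) weyl_srefl_height//; ring.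
have h0 := sum_height_cartan_gt0 hj; rewrite /= gerBl pmulr_lge0// => h.
by rewrite lt_neqAle h andbT eq_sym root_height ?rootP.
Qed.

(** [G] is constant on each coset of [WJ], while the sum [S] of [F] over a coset is the same for all
    cosets: each has a representative positive on [J], and from there the signs on the subsystem are
    determined. *)
Lemma subsystem_decorrelation (F G : {perm root} -> R) :
  {in W &, forall w w', (forall i, subsystem i -> inv_at i w = inv_at i w') -> F w = F w'} ->
  {in WJ & W, forall (v w : {perm root}), G (v * w)%g = G w} ->
  unif_mean W (fun w => F w * G w) = unif_mean W F * unif_mean W G.
Proof.
move=> FJ GJ; have sW := fintype.subsetP refl_group_sub.
pose S w := \sum_(v in WJ) F (v * w)%g.
have S_cst : {in W &, forall w w', S w = S w'}.
  move=> w w' wW wW'.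
  have [v0 v0W h0] := refl_group_positive wW; have [v1 v1W h1] := refl_group_positive wW'.
  have shift (x u : {perm root}) : x \in W -> u \in WJ -> S x = \sum_(v in WJ) F (v * (u * x))%g.
    move=> xW uW; rewrite /S (reindex_inj (mulIg u)) /=.
    by apply: eq_big => [v|v _]; rewrite ?groupMr// mulgA.
  rewrite (shift _ _ wW v0W) (shift _ _ wW' v1W); apply: eq_bigr => v vW.
  have u0W : (v0 * w)%g \in W by rewrite groupM// sW.
  have u1W : (v1 * w')%g \in W by rewrite groupM// sW.
  have vW' := sW v vW; apply: FJ => [||i si]; [exact: groupM|exact: groupM|].
  rewrite /inv_at !(permM v); apply: (@subsystem_sign (v0 * w)%g (v1 * w')%g) => //.
  exact: subsystem_refl_group.
have shiftW (H : {perm root} -> R) (v : {perm root}) : v \in WJ ->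
    \sum_(w in W) H (v * w)%g = \sum_(w in W) H w.
  move=> vW; rewrite [RHS](reindex_inj (mulgI v)) /=.
  by apply: eq_bigl => w; rewrite groupMl// sW.
(* Summing over [WJ] replaces [F] by its constant coset sum. The case [H = G] gives the covariance,
   and [H = 1] identifies the constant. *)
have key (H : {perm root} -> R) : {in WJ & W, forall (v w : {perm root}), H (v * w)%g = H w} ->
    #|WJ|%:R * (\sum_(w in W) F w * H w) = S 1%g * \sum_(w in W) H w.
  move=> HJ; rewrite mulr_natl -sumr_const.
  under eq_bigr => v vW do rewrite -(shiftW (fun w => F w * H w) v vW).
  rewrite exchange_big mulr_sumr; apply: eq_bigr => w wW /=.
  under eq_bigr => v vW do rewrite HJ//.
  by rewrite -mulr_suml -/(S w) (S_cst w 1%g).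
have kG := key G GJ; have k1 := key (fun=> 1) (fun _ _ _ _ => erefl).
have W0 : #|W|%:R != 0 :> R by rewrite pnatr_eq0 -lt0n cardG_gt0.
have WJ0 : #|WJ|%:R != 0 :> R by rewrite pnatr_eq0 -lt0n cardG_gt0.
move: k1; rewrite (eq_bigr F) => [|w _]; last by rewrite mulr1.
rewrite sumr_const => k1; apply: (mulfI WJ0); rewrite /unif_mean.
move: kG k1 W0; move: (\sum_(w in W) F w * G w) (\sum_(w in W) F w) (\sum_(w in W) G w) (S 1%g).
move: (#|W|%:R) (#|WJ|%:R) => n m a b g s kG k1 n0.
by rewrite !mulrA kG k1; field.
Qed.

End ObtuseSubsystem.

(** * Antichains in the root poset *)

Variable Psi : {set root}.
Hypothesis anti : is_antichain Delta Psi.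

Lemma antichain_pos i : i \in Psi -> 0 < height (val i).
Proof. by case: anti => h _ /h [_]; apply: comb_height; rewrite root_neq0 ?rootP. Qed.

Lemma antichain_obtuse i j : i \in Psi -> j \in Psi -> i != j ->
  dotv (val i) (val j) <= 0.
Proof.
move=> iP jP ij; rewrite leNgt; apply/negP => dij; have [pos inc] := anti.
wlog h : i j iP jP ij dij / 0 < height (val i - val j) => [H|].
  have sP : val i - val j \in Phi by rewrite root_sub ?rootP.
  have [|h|h] := ltgtP (height (val i - val j)) 0; last by have := root_height sP; rewrite h eqxx.
    by move=> h; apply: (H j i) => //; rewrite 1?eq_sym 1?dotvC// -opprB heightN oppr_gt0.
  exact: (H i j).
have sP : val i - val j \in Phi by rewrite root_sub ?rootP.
apply: (inc j i) => //; first by rewrite eq_sym.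
by apply: root_le_comb; [exact: pos|exact: pos|have [_] := (positive_rootE sP).2 h].
Qed.

(** * Angles and neighbours in an antichain *)

Definition unit_root (i : root) := (Num.sqrt (dotv (val i) (val i)))^-1 *: val i.
Definition cos_root (i j : root) := dotv (unit_root i) (unit_root j).

Lemma cos_rootC i j : cos_root i j = cos_root j i.
Proof. exact: dotvC. Qed.

Lemma cos_self i : cos_root i i = 1.
Proof.
have i0 := root_sqr_gt0 (rootP i).
rewrite /cos_root !dotv_lin mulrA -expr2 exprVn sqr_sqrtr ?mulVf ?gt_eqF// ltW//.
Qed.

Lemma cos_sign i j : exists2 k : R, 0 < k & cos_root i j = k * dotv (val i) (val j).
Proof.
exists ((Num.sqrt (dotv (val i) (val i)))^-1 * (Num.sqrt (dotv (val j) (val j)))^-1).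
  by rewrite mulr_gt0// invr_gt0 sqrtr_gt0 root_sqr_gt0// rootP.
by rewrite /cos_root !dotv_lin mulrA.
Qed.

Lemma cos_sqr i j : 4 * cos_root i j ^+ 2 = cartan (val i) (val j) * cartan (val j) (val i).
Proof.
have i0 := root_sqr_gt0 (rootP i); have j0 := root_sqr_gt0 (rootP j).
rewrite /cos_root /unit_root !dotv_lin /cartan (dotvC (val j)) !exprMn !exprVn !sqr_sqrtr ?ltW//.
by field; rewrite !gt_eqF.
Qed.

Lemma cos_le0 i j : i \in Psi -> j \in Psi -> i != j -> cos_root i j <= 0.
Proof.
move=> iP jP ij; have [k k0 ->] := cos_sign i j.
by rewrite mulr_ge0_le0 ?antichain_obtuse// ltW.
Qed.

Lemma cartan_lt0 i j : i \in Psi -> j \in Psi -> i != j -> dotv (val i) (val j) != 0 ->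
  exists2 m : nat, (0 < m)%N & cartan (val i) (val j) = - m%:R.
Proof.
move=> iP jP ij d0; have dlt : dotv (val i) (val j) < 0.
  by rewrite lt_neqAle d0 antichain_obtuse.
have : cartan (val i) (val j) < 0.
  by rewrite /cartan nmulr_rlt0 ?invr_gt0 ?root_sqr_gt0 ?rootP// pmulr_rlt0.
have /intrP[m ->] := root_cartan (rootP j) (rootP i).
rewrite ltrz0; case: m => // m _; exists m.+1 => //.
Qed.

(* [4 cos^2 = 4] would make the two roots proportional with a negative ratio. *)
Lemma cartan_pairs i j : i \in Psi -> j \in Psi -> i != j -> dotv (val i) (val j) != 0 ->
  exists m k : nat, [/\ cartan (val i) (val j) = - m%:R,
    cartan (val j) (val i) = - k%:R & (m * k)%N \in [:: 1; 2; 3]%N].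
Proof.
move=> iP jP ij d0.
have [m m0 em] := cartan_lt0 iP jP ij d0.
have ji : j != i by rewrite eq_sym.
have d0' : dotv (val j) (val i) != 0 by rewrite dotvC.
have [k k0 ek] := cartan_lt0 jP iP ji d0'.
exists m, k; split=> //.
suff : (m * k < 4)%N.
  have : (0 < m * k)%N by rewrite muln_gt0 m0.
  by case: (m * k)%N => [|[|[|[|n]]]].
rewrite ltnNge; apply/negP => mk.
have j0 := root_sqr_gt0 (rootP j); have i0 := root_sqr_gt0 (rootP i).
have mk' : 4 <= m%:R * k%:R :> R by rewrite -natrM ler_nat.
have e1 : 2 * dotv (val i) (val j) = - m%:R * dotv (val j) (val j).
  by rewrite -em /cartan divfK// gt_eqF.
have e2 : 2 * dotv (val i) (val j) = - k%:R * dotv (val i) (val i).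
  by rewrite -ek /cartan dotvC divfK// gt_eqF.
pose u := val i + (m%:R / 2) *: val j.
have u0 : 0 < height u.
  by rewrite heightD heightZ ltr_wpDr ?antichain_pos// mulr_ge0 ?divr_ge0// ltW ?antichain_pos.
have : dotv u u <= 0.
  rewrite /u !dotv_lin (dotvC (val j)).
  have : m%:R * (k%:R * dotv (val i) (val i)) = m%:R * (m%:R * dotv (val j) (val j)) :> R.
    by congr (_ * _); lra.
  have : 4 * dotv (val i) (val i) <= m%:R * k%:R * dotv (val i) (val i) by rewrite ler_pM2r.
  set x := dotv (val i) (val j) in e1 e2 *; set y := dotv _ _ in i0 e2 *.
  set z := dotv (val j) (val j) in j0 e1 *.
  have -> : x = - m%:R * z / 2 by rewrite -e1; field.
  by rewrite mulrA => h1 h2; rewrite h2 in h1; lra.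
rewrite leNgt dotv_gt0 => /negP; apply; apply: contraTneq u0 => ->.
by rewrite height0 ltxx.
Qed.

Definition nbhd (i : root) := [set j in Psi | dotv (val j) (val i) != 0].

Lemma nbhd_self i : i \in Psi -> i \in nbhd i.
Proof. by move=> iP; rewrite inE iP gt_eqF// root_sqr_gt0 ?rootP. Qed.

Lemma nbhd_sub i : nbhd i \subset Psi.
Proof. by apply/fintype.subsetP => j; rewrite inE => /andP[]. Qed.

Lemma cos_edge i j : i \in Psi -> j \in nbhd i -> j != i -> cos_root i j <= - 2^-1.
Proof.
rewrite inE => iP /andP[jP d0] ji; have c0 := cos_le0 jP iP ji.
have [m [k [em ek mk]]] := cartan_pairs jP iP ji d0.
have := cos_sqr j i; rewrite em ek mulrNN -natrM (cos_rootC i).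
have : 1 <= (m * k)%:R :> R by rewrite ler1n; move: mk; case: (m * k)%N.
by move=> h1 h2; rewrite -h2 in h1; nra.
Qed.

(* Positivity of [|2 e_i + sum_j e_j|^2] over the neighbours [j] of [i]. *)
Lemma nbhd_card i : i \in Psi -> (#|nbhd i| <= 5)%N.
Proof.
move=> iP; pose A := nbhd i :\ i.
rewrite (cardsD1 i) nbhd_self// -/A ltnS.
have AP j : j \in A -> [/\ j != i, j \in Psi & j \in nbhd i].
  by rewrite !inE => /andP[-> /andP[-> ->]].
pose S := \sum_(j in A) unit_root j.
have h1 : dotv (unit_root i) S <= - 2^-1 * #|A|%:R.
  rewrite dotv_sumr mulr_natr -sumr_const; apply: ler_sum => j /AP[ji jP jN].
  exact: cos_edge.
have h2 : dotv S S <= #|A|%:R.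
  rewrite dotv_suml -sumr_const; apply: ler_sum => j jA; have [_ jP _] := AP j jA.
  rewrite dotv_sumr (bigD1 j)//= -/(cos_root j j) cos_self gerDl.
  by rewrite sumr_le0// => k /andP[/AP[_ kP _] kj]; rewrite cos_le0// eq_sym.
have expand u v : dotv (2 *: u + v) (2 *: u + v) = 4 * dotv u u + 4 * dotv u v + dotv v v.
  by rewrite !dotv_lin (dotvC v u); ring.
have := dotv_ge0 (2 *: unit_root i + S).
rewrite expand -/(cos_root i i) cos_self.
rewrite -(@ler_nat R); lra.
Qed.

(** * Sign variables and their covariances *)

Local Notation X := inv_at.
Local Notation sf := (fun (i : root) w => (srefl (val i) * w)%g).
Local Notation E := (@unif_mean R _ W).
Local Notation W0 := (cardG_gt0 W).

Lemma flip_invol i : involutive (sf i).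
Proof.
move=> w; apply/permP => j; rewrite mulgA !permM; congr (w _).
by apply: val_inj; rewrite !srefl_val ?rootP// reflK// root_neq0// rootP.
Qed.

Lemma flip_weyl i : {in W, forall w, sf i w \in W}.
Proof. by move=> w wW; rewrite groupM// srefl_weyl// rootP. Qed.

Lemma flip_inv_at i : {in W, forall w, X i (sf i w) = ~~ X i w}.
Proof. by move=> w; exact: inv_at_srefl. Qed.

Lemma inv_at_flip i j w : X j (sf i w) = X (srefl (val i) j) w.
Proof. by rewrite /inv_at permM. Qed.

Lemma srefl_orth (i j : root) : dotv (val j) (val i) = 0 -> srefl (val i) j = j.
Proof. by move=> h; apply: val_inj; rewrite srefl_val ?rootP// refl_orth. Qed.

Let mean1 i : i \in Psi -> E (fun w => (X i w)%:R) = 2^-1.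
Proof.
by move=> iP; apply: (@flip_mean1 R _ _ W Psi X sf W0) => // *;
  [exact: flip_invol|exact: flip_weyl|exact: flip_inv_at].
Qed.

(** The flip of [i] fixes [X j], so the exchange identity with test function [X j] has a zero
    right-hand side. *)
Lemma mean_orth i j : i \in Psi -> j \in Psi -> dotv (val j) (val i) = 0 ->
  E (fun w => (X i w)%:R * (X j w)%:R) = 4^-1.
Proof.
move=> iP jP d0.
have := @flip_exchange R _ _ W Psi X sf (fun i _ => @flip_invol i) (fun i _ => @flip_weyl i)
  (fun i _ => @flip_inv_at i) i (fun w => (X j w)%:R) iP.
under [in X in _ = X]mean_eq do rewrite inv_at_flip srefl_orth// subrr mulr0.
rewrite mean_cst// mulr0 => h; move: h.
under mean_eq do rewrite mulrBl.
rewrite meanB meanZ mean1// => /eqP; rewrite subr_eq0 => /eqP ->; by field.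
Qed.

(* Action of the two reflections of a rank two subsystem, with Cartan integers
   [-1] and [-k], on the pair of heights of the two simple roots. *)
Definition rank2_step (k : R) (b : bool) (p : R * R) : R * R :=
  if b then (- p.1, p.2 + p.1) else (p.1 + k * p.2, - p.2).

Definition alternating (b : bool) n : seq bool := mkseq (fun k => odd k (+) b) n.

(** One reduced word for each of the [2 n] elements of the dihedral group of order [2 n]; the
    longest element comes last. *)
Definition rank2_words n : seq (seq bool) :=
  rcons ([seq alternating true k | k <- iota 0 n] ++
         [seq alternating false k.+1 | k <- iota 0 n.-1]) (alternating true n).

(** The images of the negative chamber cover the plane up to walls, which the nonvanishing
    hypothesis avoids. Each word contributes a disjunction of linear inequalities in [a] and [b],
    and jointly these are contradictory. *)
Lemma rank2_descend (k n : nat) (a b : R) :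
  (k, n) \in [:: (1, 3); (2, 4); (3, 6)]%N ->
  (forall s, let p := foldr (rank2_step k%:R) (a, b) s in p.1 != 0 /\ p.2 != 0) ->
  exists2 s, s \in rank2_words n &
    let p := foldr (rank2_step k%:R) (a, b) s in (p.1 < 0) && (p.2 < 0).
Proof.
move=> kn nz; apply/hasP; case: hasP => // H; exfalso.
have {}H s : s \in rank2_words n ->
    let p := foldr (rank2_step k%:R) (a, b) s in 0 < p.1 \/ 0 < p.2.
  move=> sL; have [p1 p2] := nz s; move: p1 p2 => /=.
  set p := foldr _ _ _ => p1 p2.
  have [|q1] := ltP 0 p.1; first by left.
  have [|q2] := ltP 0 p.2; first by right.
  by case: H; exists s => //=; rewrite -/p !lt_neqAle p1 p2 q1 q2.
move: {nz} kn H; rewrite !inE => /or3P[] /eqP[-> ->] H.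
- have := H [::] isT; have := H [:: true] isT; have := H [:: false] isT.
  have := H [:: true; false] isT; have := H [:: false; true] isT.
  have := H [:: true; false; true] isT => /=.
  by do ![case=> ?]; lra.
- have := H [:: true; false; true; false] isT.
  have := H [:: true; false; true] isT; have := H [:: false; true; false] isT.
  have := H [:: true; false] isT; have := H [:: false; true] isT.
  have := H [:: true] isT; have := H [:: false] isT; have := H [::] isT => /=.
  by do ![case=> ?; try lra].
have := H [:: true; false; true; false; true; false] isT.
have := H [:: true; false; true; false; true] isT.
have := H [:: false; true; false; true; false] isT.
have := H [:: true; false; true; false] isT; have := H [:: false; true; false; true] isT.
have := H [:: true; false; true] isT; have := H [:: false; true; false] isT.
have := H [:: true; false] isT; have := H [:: false; true] isT.
have := H [:: true] isT; have := H [:: false] isT; have := H [::] isT => /=.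
by do ![case=> ?; try lra].
Qed.

Definition rank2_word (i j : root) (s : seq bool) : {perm root} :=
  foldr (fun (b : bool) (v : {perm root}) => (srefl (val (if b then i else j)) * v)%g) 1%g s.

Lemma rank2_word_weyl i j s : rank2_word i j s \in W.
Proof.
by elim: s => [|b s IH] /=; rewrite ?group1// groupM// srefl_weyl// rootP.
Qed.

Lemma rank2_word_height i j (k : R) s w : w \in W ->
  cartan (val j) (val i) = -1 -> cartan (val i) (val j) = - k ->
  foldr (rank2_step k) (height (val (w i)), height (val (w j))) s =
  (height (val ((rank2_word i j s * w)%g i)), height (val ((rank2_word i j s * w)%g j))).
Proof.
move=> wW ci cj; elim: s => [|b s IH]; first by rewrite /= mul1g.
rewrite [LHS]/= IH; set u := (rank2_word i j s * w)%g.
have uW : u \in W by rewrite groupM// rank2_word_weyl.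
case: b; rewrite [rank2_word _ _ _]/= -mulgA -/u !(permM (srefl _)) !weyl_srefl_height//.
  by rewrite /rank2_step /= ci cartan_self ?root_neq0 ?rootP//; congr (_, _); ring.
by rewrite /rank2_step /= cj cartan_self ?root_neq0 ?rootP//; congr (_, _); ring.
Qed.

(** For every [w] one of the [2 n] translates by words inverts both roots; [mean_cover]
    concludes. *)
Lemma mean_rank2 (k n : nat) i j : (k, n) \in [:: (1, 3); (2, 4); (3, 6)]%N ->
  cartan (val j) (val i) = -1 -> cartan (val i) (val j) = - k%:R ->
  1 <= (2 * n)%:R * E (fun w => (X i w)%:R * (X j w)%:R).
Proof.
move=> kn ci cj; pose L := [seq rank2_word i j s | s <- rank2_words n].
have -> : (2 * n)%N = size L.
  by move: kn; rewrite size_map !inE => /or3P[] /eqP[_ ->].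
have -> : E (fun w => (X i w)%:R * (X j w)%:R) = E (fun w => (X i w && X j w)%:R).
  by apply: mean_eq => w _; rewrite -natrM mulnb.
apply: mean_cover => [_ /mapP[s _ ->]|w wW]; first exact: rank2_word_weyl.
have [|s sL] := @rank2_descend k n (height (val (w i))) (height (val (w j))) kn.
  by move=> s; rewrite rank2_word_height//= !root_height ?rootP.
rewrite rank2_word_height//= => h; exists (rank2_word i j s) => //.
exact: map_f.
Qed.

(** The lower bounds on [p - 1/4] are [-1/12], [-1/8], [-1/6] for the cosines [-1/2], [-sqrt 2 / 2],
    [-sqrt 3 / 2]; the factor [1/5] suits all three. *)
Lemma rank2_cov (k n : nat) (c p : R) : (k, n) \in [:: (1, 3); (2, 4); (3, 6)]%N ->
  c <= - 2^-1 -> 4 * c ^+ 2 = k%:R -> 1 <= (2 * n)%:R * p -> c / 5 <= p - 4^-1.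
Proof.
rewrite !inE natrM => /or3P[] /eqP[-> ->] c0 c2 hp; first by lra.
  by have : c <= - (5 / 8); [nra|lra].
by have : c <= - (5 / 6); [nra|lra].
Qed.

Lemma mean_edge (k n : nat) i j : i \in Psi -> j \in nbhd i -> j != i ->
  (k, n) \in [:: (1, 3); (2, 4); (3, 6)]%N ->
  cartan (val j) (val i) = -1 -> cartan (val i) (val j) = - k%:R ->
  cos_root i j / 5 <= E (fun w => (X i w)%:R * (X j w)%:R) - 4^-1.
Proof.
move=> iP jN ji kn ci cj; apply: (rank2_cov kn (cos_edge iP jN ji)).
  by rewrite cos_sqr ci cj mulrNN mulr1.
exact: mean_rank2 kn ci cj.
Qed.

(* Summed over [i] and [j], the cosines form the squared norm of a vector. *)
Lemma cov_lb i j : i \in Psi -> j \in Psi ->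
  cos_root i j / 5 + (j == i)%:R / 20 <=
  E (fun w => (X i w)%:R * (X j w)%:R) - E (fun w => (X i w)%:R) * E (fun w => (X j w)%:R).
Proof.
move=> iP jP; rewrite !mean1//.
have -> : 2^-1 * 2^-1 = 4^-1 :> R by field.
have [->|ji] := eqVneq j i.
  (* On the diagonal [1/5 + 1/20] is exactly the variance [1/4] of a fair bit. *)
  rewrite cos_self; under mean_eq do rewrite -natrM mulnb andbb.
  by rewrite mean1//=; lra.
rewrite mul0r addr0.
have [d0|d0] := eqVneq (dotv (val j) (val i)) 0.
  have [k _ ->] := cos_sign i j.
  by rewrite dotvC d0 mulr0 mul0r mean_orth// subrr.
have jN : j \in nbhd i by rewrite inE jP.
have iN : i \in nbhd j by rewrite inE iP dotvC.
have ij : i != j by rewrite eq_sym.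
have [m [k [em ek mk]]] := cartan_pairs jP iP ji d0.
have nP q : q \in [:: 1; 2; 3]%N -> exists n, (q, n) \in [:: (1, 3); (2, 4); (3, 6)]%N.
  by rewrite !inE => /or3P[] /eqP ->; [exists 3%N|exists 4%N|exists 6%N].
(* The product of the Cartan integers is below four, so one of them is [-1]; which one decides the
   order of [i] and [j] in [mean_edge]. *)
have [m1|k1] : m = 1%N \/ k = 1%N.
  have /andP[lt4 gt0] : (m * k < 4)%N && (0 < m * k)%N.
    by move: mk; case: (m * k)%N => [|[|[|[|n]]]].
  have /andP[m0 k0] : (0 < m)%N && (0 < k)%N by rewrite -muln_gt0.
  have [m2|m1] := ltnP 1 m; last by left; apply/eqP; rewrite eqn_leq m1.
  have [k2|k1] := ltnP 1 k; last by right; apply/eqP; rewrite eqn_leq k1.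
  by have := leq_mul m2 k2; rewrite leqNgt lt4.
  rewrite m1 mul1n in mk em; have [n kn] := nP _ mk.
  exact: (mean_edge iP jN ji kn em ek).
rewrite k1 muln1 in mk ek; have [n kn] := nP _ mk.
rewrite cos_rootC; have := mean_edge jP iN ij kn ek em.
by under mean_eq do rewrite mulrC.
Qed.

(** * Variances of the statistic and of its Stein coefficient *)

Local Notation Y := (fun w => (\sum_(i in Psi) X i w)%N%:R : R).
Local Notation sgn i w := (1 - 2 * (X i w)%:R : R).
Local Notation G := (fun i w => sgn i w * (Y (sf i w) - Y w)).

Lemma var_lb : 20^-1 * #|Psi|%:R <= unif_var W Y.
Proof.
have -> : Y = (fun w => \sum_(i in Psi) (X i w)%:R) by apply/funext => w; rewrite natr_sum.
rewrite var_sum//.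
apply: le_trans (_ : \sum_(i in Psi) \sum_(j in Psi)
   (cos_root i j / 5 + (j == i)%:R / 20) <= _); last first.
  by apply: ler_sum => i iP; apply: ler_sum => j jP; exact: cov_lb.
have -> : \sum_(i in Psi) \sum_(j in Psi) (cos_root i j / 5 + (j == i)%:R / 20) =
   dotv (\sum_(i in Psi) unit_root i) (\sum_(i in Psi) unit_root i) / 5 + 20^-1 * #|Psi|%:R.
  rewrite dotv_suml mulr_natr -sumr_const mulr_suml -big_split; apply: eq_bigr => i iP /=.
  rewrite dotv_sumr mulr_suml big_split; congr (_ + _).
  rewrite (bigD1 i)//= eqxx mul1r big1 ?addr0// => j /andP[_ /negbTE ->].
  by rewrite mul0r.
by rewrite lerDr divr_ge0// dotv_ge0.
Qed.

Lemma flip_diff i w : i \in Psi ->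
  Y (sf i w) - Y w = \sum_(j in nbhd i) ((X (srefl (val i) j) w)%:R - (X j w)%:R).
Proof.
move=> iP; rewrite /= !natr_sum -sumrB (big_setID (nbhd i)) /=.
rewrite (finset.setIidPr (nbhd_sub i)) [X in _ + X]big1 ?addr0 => [|j].
  by apply: eq_bigr => j _; rewrite inv_at_flip.
rewrite !inE => /andP[+ jP]; rewrite jP negbK => /eqP d0.
by rewrite inv_at_flip srefl_orth// subrr.
Qed.

Lemma flip_diff_bound i w : i \in Psi -> `|Y (sf i w) - Y w| <= 5.
Proof.
move=> iP; rewrite flip_diff//; apply: le_trans (ler_norm_sum _ _ _) _.
apply: le_trans (_ : #|nbhd i|%:R <= _); last by rewrite -[5]/(5%:R) ler_nat nbhd_card.
rewrite -sumr_const; apply: ler_sum => j _.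
by case: (X _ _); case: (X _ _); rewrite /= ?subrr ?subr0 ?sub0r ?normrN ?normr0 ?normr1.
Qed.

Lemma coef_bound i w : i \in Psi -> `|G i w| <= 5.
Proof. by move=> iP; rewrite normrM flip_norm mul1r flip_diff_bound. Qed.

(** Distance at least four in the graph on [Psi] that joins non-orthogonal roots. *)
Definition far (i j : root) :=
  [forall k in nbhd i, forall l in nbhd j, dotv (val l) (val k) == 0].

(** Three steps in the graph of non-orthogonality, each multiplying the count by at most five. *)
Lemma near_card i : i \in Psi -> (#|[set j in Psi | ~~ far i j]| <= 125)%N.
Proof.
move=> iP.
have step (A : {set root}) n : A \subset Psi -> (#|A| <= n)%N ->
    (\bigcup_(k in A) nbhd k \subset Psi) && (#|\bigcup_(k in A) nbhd k| <= 5 * n)%N.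
  move=> AP An; apply/andP; split; first by apply/bigcupsP => k _; exact: nbhd_sub.
  apply: leq_trans (_ : \sum_(k in A) #|nbhd k| <= _)%N.
    elim/big_rec2: _ => [|k m B kA IH]; first by rewrite cards0.
    by rewrite (leq_trans (leq_card_setU _ _))// leq_add2l.
  apply: leq_trans (_ : \sum_(k in A) 5 <= _)%N.
    by apply: leq_sum => k kA; rewrite nbhd_card// (fintype.subsetP AP).
  by rewrite sum_nat_const mulnC leq_mul2l.
have /andP[s2 c2] := step _ _ (nbhd_sub i) (nbhd_card iP).
have /andP[s3 c3] := step _ _ s2 c2.
apply: leq_trans c3; apply: subset_leq_card; apply/fintype.subsetP => j.
rewrite inE => /andP[jP]; rewrite negb_forall_in => /exists_inP[k kN].
rewrite negb_forall_in => /exists_inP[l lN d0].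
have lP : l \in Psi by rewrite (fintype.subsetP (nbhd_sub j)).
apply/bigcupP; exists l.
  by apply/bigcupP; exists k; rewrite // inE lP.
by move: lN; rewrite !inE jP dotvC => /andP[].
Qed.

(** [G i] depends only on signs in the subsystem of [nbhd i], which contains the images of
    neighbours under the flip, and the reflections in [nbhd i] fix every root that [G j] reads. *)
Lemma far_decorrelated i j : i \in Psi -> j \in Psi -> far i j ->
  E (fun w => G i w * G j w) = E (G i) * E (G j).
Proof.
move=> iP jP fij.
have NP k : k \in nbhd i -> k \in Psi by move/(fintype.subsetP (nbhd_sub i)).
have sub0 k : k \in nbhd i -> subsystem (nbhd i) k by exact: subsystem_mem.
apply: (@subsystem_decorrelation (nbhd i)) => [k /NP|k l /NP kP /NP lP kl|w w' wW wW' ww'|].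
- exact: antichain_pos.
- exact: antichain_obtuse.
- have iN := nbhd_self iP.
  have e k : k \in nbhd i -> X k w = X k w' by move=> kN; apply: ww'; exact: sub0.
  rewrite !flip_diff//= e//; congr (_ * _); apply: eq_bigr => k kN.
  by rewrite (e k kN) (ww' (srefl _ k))//; apply: subsystem_srefl => //; exact: sub0.
move=> v w vW wW.
have fixv (x : root) : {in nbhd i, forall k, dotv (val x) (val k) = 0} -> v x = x.
  move=> xk; elim/refl_group_ind: v / vW => [|k v kN IH]; first by rewrite perm1.
  by rewrite permM srefl_orth ?xk.
have d0 l k : l \in nbhd j -> k \in nbhd i -> dotv (val l) (val k) = 0.
  by move=> lN kN; move/forall_inP: fij => /(_ k kN) /forall_inP/(_ l lN)/eqP.
have Xv (x : root) : {in nbhd i, forall k, dotv (val x) (val k) = 0} -> X x (v * w)%g = X x w.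
  by move=> h; rewrite /inv_at permM fixv.
have jN := nbhd_self jP.
rewrite !flip_diff//= Xv => [|k kN]; last exact: d0.
congr (_ * _); apply: eq_bigr => l lN; rewrite !Xv// => k kN; first exact: d0.
by rewrite srefl_val ?rootP// reflE dotvBl dotvZl !d0// mulr0 subr0.
Qed.

(** For each [i] only the at most 125 roots [j] not far from it contribute, each at most
    [2 * 5^2]. *)
Lemma var_coef : unif_var W (fun w => \sum_(i in Psi) G i w) <= 6250 * #|Psi|%:R.
Proof.
rewrite var_sum// mulr_natr -sumr_const; apply: ler_sum => i iP.
apply: le_trans (_ : \sum_(j in [set j in Psi | ~~ far i j]) 50 <= _); last first.
  rewrite sumr_const -(mulr_natr 50) -[6250]/(6250%:R) (_ : 6250 = 50 * 125)%N// natrM.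
  by rewrite ler_wpM2l// ler_nat near_card.
rewrite [leRHS]big_mkcond [leLHS]big_mkcond /=; apply: ler_sum => j _; rewrite inE.
case: ifP => //= jP; have [fij|nf] := boolP (far i j) => /=.
  by rewrite far_decorrelated// subrr.
have := @mean_cov_bound R _ W (G i) (G j) 5 W0 (fun w _ => coef_bound w iP)
  (fun w _ => coef_bound w jP).
by move=> h; apply: le_trans h _; lra.
Qed.

(** The constant involves neither the root system nor the antichain, so it is uniform along any
    sequence. *)
Lemma antichain_berry_esseen (x : R) : (0 < #|Psi|)%N ->
  `|unif_cdf W (standardize W (fun w => (X_set Delta Psi w)%:R)) x - std_normal_cdf x|
   <= flip_constant (5 : R) 6250 20^-1 * (Num.sqrt (#|Psi|%:R))^-1.
Proof.
move=> P0; have -> : (fun w => (X_set Delta Psi w)%:R) = Y.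
  by apply/funext => w; congr (_%:R); apply: eq_bigr => i _; rewrite X_rootE.
have c0 : 0 < 20^-1 :> R by rewrite invr_gt0.
have B0 : 0 < 5 :> R by [].
have V0 : 0 <= 6250 :> R by rewrite ler0n.
have YB i : i \in Psi -> {in W, forall w, `|Y (sf i w) - Y w| <= 5}.
  by move=> iP w _; apply: flip_diff_bound.
exact: (@flip_berry_esseen R _ _ W Psi X sf 5 6250 20^-1 W0 P0
  (fun i _ => @flip_invol i) (fun i _ => @flip_weyl i) (fun i _ => @flip_inv_at i)
  c0 B0 V0 YB var_coef var_lb x).
Qed.

End RootSystem.

(** * Sequences of root systems *)

Unset Implicit Arguments.
Local Open Scope classical_set_scope.

Theorem theorem2p6 (R : realType) (d : nat -> nat)
  (Phi Delta : forall n : nat, seq 'rV[R]_(d n))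
  (Psi : forall n : nat, {set seq_sub (Phi n)}) :
  (forall n, crystallographic_root_system (Phi n)) ->
  (forall n, simple_system (Phi n) (Delta n)) ->
  (forall n, is_antichain (Delta n) (Psi n)) ->
  (forall M : nat, exists N : nat, forall n, (N <= n)%N -> (M <= #|Psi n|)%N) ->
  let Z n : {perm seq_sub (Phi n)} -> R :=
    standardize (weyl_group (Phi n) (Delta n))
      (fun w => (X_set (Delta n) (Psi n) w)%:R) in
  (forall x : R,
     (fun n => unif_cdf (weyl_group (Phi n) (Delta n)) (Z n) x) @ \oo
       --> std_normal_cdf x) /\
  (exists C : R, exists N : nat, forall n, (N <= n)%N -> forall x : R,
     `|unif_cdf (weyl_group (Phi n) (Delta n)) (Z n) x - std_normal_cdf x|
       <= C * (Num.sqrt (#|Psi n|%:R))^-1).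
Proof.
move=> crys simp anti large Z; set C := flip_constant (5 : R) 6250 20^-1.
have bound n x : (0 < #|Psi n|)%N ->
    `|unif_cdf (weyl_group (Phi n) (Delta n)) (Z n) x - std_normal_cdf x|
      <= C * (Num.sqrt (#|Psi n|%:R))^-1.
  exact: antichain_berry_esseen.
split; last by have [N hN] := large 1%N; exists C, N => n /hN h x; exact: bound.
move=> x; apply/cvgrPdist_le => e e0.
(* An antichain with more than [M] elements has more than [(C / e)^2], which puts the error bound
   below [e]. *)
pose M := Num.bound ((C / e) ^+ 2).
have [N hN] := large M.+1; near=> n.
have Mn : (M < #|Psi n|)%N by apply: hN; near: n; exact: nbhs_infty_ge.
have P0 : (0 < #|Psi n|)%N by exact: leq_ltn_trans Mn.
have s0 : 0 < Num.sqrt (#|Psi n|%:R : R) by rewrite sqrtr_gt0 ltr0n.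
rewrite distrC; apply: le_trans (bound n x P0) _.
rewrite ler_pdivrMr// -ler_pdivrMl// mulrC; apply: le_trans (ler_norm _) _.
rewrite -sqrtr_sqr ler_wsqrtr//; apply: ltW; apply: lt_trans (archi_boundP (sqr_ge0 _)) _.
by rewrite ltr_nat.
Unshelve. all: by end_near.
Qed.
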